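(* Let $\Sigma(\mathsf{o}_{in}, \mathsf{o}_{out}, \vec a)$ be a $\Delta_0$ formula which implicitly defines $\mathsf{o}_{out}$ as a function of $\mathsf{o}_{in}$. Then there is an $\mathrm{NRC}$ expression $E$ (in the variant $\mathrm{NRC}[\mathsf{get}]$, i.e. possibly using the $\mathsf{get}$ operator) with the single free variable $\mathsf{o}_{in}$ such that for all nested relations $\mathsf{o}_{in}, \mathsf{o}_{out}, \vec a$ of the appropriate types, if $\Sigma(\mathsf{o}_{in}, \mathsf{o}_{out}, \vec a)$ holds then $E(\mathsf{o}_{in}) = \mathsf{o}_{out}$.
   Context: Types are generated by $T, U ::= \mathfrak{U} \mid \mathsf{Unit} \mid T \times U \mid \mathsf{Set}(T)$. Here $\mathfrak{U}$ is an arbitrary set of atoms (''Ur-elements''), $\mathsf{Unit}$ has a single element $\langle\rangle$, $T\times U$ is the cartesian product, and $\mathsf{Set}(T)$ is the set of all (finite or infinite) subsets of $T$. A nested relation of type $T$ is an element of the interpretation of $T$. Terms are $t,u ::= x \mid \langle\rangle \mid \langle t,u\rangle \mid \pi_1(t) \mid \pi_2(t)$ (well-typed). $\Delta_0$ formulas are $\varphi,\psi ::= t =_{\mathfrak U} u \mid t \neq_{\mathfrak U} u \mid \top \mid \bot \mid \varphi\vee\psi \mid \varphi\wedge\psi \mid \forall x \in t\,\varphi \mid \exists x\in t\,\varphi$, where in the bounded quantifiers $t$ has type $\mathsf{Set}(T)$ and $x$ has type $T$; $\neg\varphi$ is defined by dualizing all connectives and atoms, and $\varphi\to\psi := \neg\varphi\vee\psi$.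 Formulas are evaluated under assignments of nested relations to their free variables. A $\Delta_0$ formula $\Sigma(\vec i, o, \vec a)$ implicitly defines $o$ as a function of $\vec i$ if for any two assignments $\sigma_1,\sigma_2$ of nested relations (finite or infinite) to all free variables that both satisfy $\Sigma$, $\sigma_1(\vec i)=\sigma_2(\vec i)$ implies $\sigma_1(o)=\sigma_2(o)$. $\mathrm{NRC}[\mathsf{get}]$ expressions are typed expressions with free variables built from: variables; $\langle\rangle$; pairing $\langle E_1,E_2\rangle$; projections $\pi_1(E),\pi_2(E)$; the empty set $\emptyset$ of any type $\mathsf{Set}(T)$; singleton $\{E\}$; union $E_1\cup E_2$ and difference $E_1\setminus E_2$ of expressions of the same set type; the big union $\bigcup\{E_1 \mid x \in E_2\}$ (with $E_2:\mathsf{Set}(T)$, $x$ a variable of type $T$ bound in $E_1:\mathsf{Set}(U)$), denoting the union over all $x\in E_2$ of the values of $E_1$; and $\mathsf{get}_T(E)$ for $E:\mathsf{Set}(T)$, returning the unique element of $E$ if $E$ is a singleton and a fixed default element of $T$ otherwise. $\mathrm{NRC}$ is the fragment without $\mathsf{get}$. Booleans are encoded as $\mathsf{Set}(\mathsf{Unit})$ with true $=\{\langle\rangle\}$, false $=\emptyset$. *)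

(* Defs.v *)
From Stdlib Require Import List Classical ClassicalEpsilon.
Import ListNotations.
Set Implicit Arguments.

Inductive ty : Type :=
| TUr : ty
| TUnit : ty
| TProd : ty -> ty -> ty
| TSet : ty -> ty.

Fixpoint interp (A : Type) (T : ty) : Type :=
  match T with
  | TUr => A
  | TUnit => unit
  | TProd T1 T2 => (interp A T1 * interp A T2)%type
  | TSet T1 => interp A T1 -> Prop
  end.

Inductive var : list ty -> ty -> Type :=
| VZ : forall G T, var (T :: G) T
| VS : forall G S T, var G T -> var (S :: G) T.

Fixpoint env (A : Type) (G : list ty) : Type :=
  match G with
  | nil => unit
  | T :: G' => (interp A T * env A G')%type
  end.

Fixpoint lookup {A : Type} {G : list ty} {T : ty} (v : var G T) : env A G -> interp A T :=
  match v in var G T return env A G -> interp A T with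
  | @VZ _ _ => fun rho => fst rho
  | @VS G' S' T' v' => fun rho => @lookup A G' T' v' (snd rho)
  end.

Inductive term (G : list ty) : ty -> Type :=
| tvar : forall T, var G T -> term G T
| tunit : term G TUnit
| tpair : forall T1 T2, term G T1 -> term G T2 -> term G (TProd T1 T2)
| tfst : forall T1 T2, term G (TProd T1 T2) -> term G T1
| tsnd : forall T1 T2, term G (TProd T1 T2) -> term G T2.

Fixpoint teval {A : Type} {G : list ty} {T : ty} (t : term G T) (rho : env A G)
  : interp A T :=
  match t with
  | tvar v => lookup v rho
  | tunit _ => tt
  | tpair t1 t2 => (teval t1 rho, teval t2 rho)
  | tfst t1 => fst (teval t1 rho)
  | tsnd t1 => snd (teval t1 rho)
  end.

Inductive fml (G : list ty) : Type :=
| feq : term G TUr -> term G TUr -> fml G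
| fneq : term G TUr -> term G TUr -> fml G
| ftop : fml G
| fbot : fml G
| for_ : fml G -> fml G -> fml G
| fand : fml G -> fml G -> fml G
| fall : forall T, term G (TSet T) -> fml (T :: G) -> fml G
| fex : forall T, term G (TSet T) -> fml (T :: G) -> fml G.

Fixpoint sat {A : Type} {G : list ty} (rho : env A G) (phi : fml G) : Prop :=
  match phi with
  | feq t u => teval t rho = teval u rho
  | fneq t u => teval t rho <> teval u rho
  | ftop _ => True
  | fbot _ => False
  | for_ p q => sat rho p \/ sat rho q
  | fand p q => sat rho p /\ sat rho q
  | fall t p => forall x, teval t rho x -> sat ((x, rho) : env A (_ :: G)) p
  | fex t p => exists x, teval t rho x /\ sat ((x, rho) : env A (_ :: G)) p
  end.

Inductive expr (G : list ty) : ty -> Type :=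
| evar : forall T, var G T -> expr G T
| eunit : expr G TUnit
| epair : forall T1 T2, expr G T1 -> expr G T2 -> expr G (TProd T1 T2)
| efst : forall T1 T2, expr G (TProd T1 T2) -> expr G T1
| esnd : forall T1 T2, expr G (TProd T1 T2) -> expr G T2
| eempty : forall T, expr G (TSet T)
| esing : forall T, expr G T -> expr G (TSet T)
| eunion : forall T, expr G (TSet T) -> expr G (TSet T) -> expr G (TSet T)
| ediff : forall T, expr G (TSet T) -> expr G (TSet T) -> expr G (TSet T)
| ebigunion : forall T U, expr (T :: G) (TSet U) -> expr G (TSet T) -> expr G (TSet U)
| eget : forall T, expr G (TSet T) -> expr G T.

Fixpoint dflt {A : Type} (u0 : A) (T : ty) : interp A T :=
  match T with
  | TUr => u0
  | TUnit => tt
  | TProd T1 T2 => (dflt u0 T1, dflt u0 T2)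
  | TSet _ => fun _ => False
  end.

Definition get_sem {A : Type} (u0 : A) {T : ty} (s : interp A T -> Prop) : interp A T :=
  match excluded_middle_informative (exists! x, s x) with
  | left H => proj1_sig (constructive_indefinite_description _ H)
  | right _ => dflt u0 T
  end.

Fixpoint eeval {A : Type} (u0 : A) {G : list ty} {T : ty} (e : expr G T) (rho : env A G)
  : interp A T :=
  match e in expr _ T return interp A T with
  | evar v => lookup v rho
  | eunit _ => tt
  | epair e1 e2 => (eeval u0 e1 rho, eeval u0 e2 rho)
  | efst e1 => fst (eeval u0 e1 rho)
  | esnd e1 => snd (eeval u0 e1 rho)
  | eempty _ _ => fun _ => False
  | esing e1 => fun x => x = eeval u0 e1 rho
  | eunion e1 e2 => fun x => eeval u0 e1 rho x \/ eeval u0 e2 rho x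
  | ediff e1 e2 => fun x => eeval u0 e1 rho x /\ ~ eeval u0 e2 rho x
  | ebigunion e1 e2 =>
      fun y => exists x, eeval u0 e2 rho x /\ eeval u0 e1 ((x, rho) : env A (_ :: G)) y
  | eget e1 => get_sem u0 (eeval u0 e1 rho)
  end.

(* Sigma(o_in, o_out, a) implicitly defines o_out as a function of o_in:
   for every set of atoms A and all assignments (finite or infinite). *)
Definition implicitly_defines (Tin Tout : ty) (As : list ty)
  (Sigma : fml (Tin :: Tout :: As)) : Prop :=
  forall (A : Type) (i : interp A Tin) (o1 o2 : interp A Tout) (a1 a2 : env A As),
    sat ((i, (o1, a1)) : env A (Tin :: Tout :: As)) Sigma ->
    sat ((i, (o2, a2)) : env A (Tin :: Tout :: As)) Sigma ->
    o1 = o2.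

(* Main.v *)
Require Import Defs.
From Stdlib Require Import List Bool Arith Lia Classical ClassicalEpsilon
  FunctionalExtensionality PropExtensionality Eqdep.
Import ListNotations.
Set Implicit Arguments.

(** A Henkin-style argument. Take a left and a right set of formulas sharing only the input
    variables, and a left-hand object [r]. Call the pair separable if there are NRC expressions
    [E] and [th] over the shared variables such that the left side implies [th \/ r \in E] and
    the right side refutes [th]. Separability propagates backwards through the tableau rules,
    because members of shared sets are made shared and then eliminated by big unions over those
    sets. Hence an inseparable pair saturates to a Hintikka set, whose collapse is a joint model
    in nested relations.

    If [o] is implicitly defined and [r] is an element of the left copy of [o], then requiring
    [r] to be outside the right copy leaves no joint model, so [E] contains all elements of [o].
    For [r] a set this uses an expression [c] containing the elements of [r], given by induction
    on the type: "[r] differs from [w]" becomes "some shared [z \in c] belongs to exactly one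
    of [r], [w]". Plain interpolation finally selects [o] among the collected candidates. *)

Lemma set_ext (X : Type) (P Q : X -> Prop) : (forall x, P x <-> Q x) -> P = Q.
Proof.
  intros H; apply functional_extensionality; intros x.
  apply propositional_extensionality; auto.
Qed.

(** * Names, tuples of names and valuations *)

(* Label of a name: shared by both sides, or private to the left ([true]) or right side. *)
Inductive lab := LC | LS (j : bool).
Definition name : Type := (lab * nat)%type.

Lemma name_dec (a b : name) : {a = b} + {a <> b}.
Proof. repeat decide equality. Qed.

Lemma ty_dec (a b : ty) : {a = b} + {a <> b}.
Proof. decide equality. Qed.

(* Syntactic counterpart of [interp]: product types are decomposed into pairs, so a formula
   paired with an environment of such tuples needs neither substitution nor projections. *)
Fixpoint tm (T : ty) : Type :=
  match T with
  | TUr => name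
  | TUnit => unit
  | TProd a b => (tm a * tm b)%type
  | TSet _ => name
  end.

Fixpoint tenv (G : list ty) : Type :=
  match G with
  | nil => unit
  | T :: G' => (tm T * tenv G')%type
  end.

(** Names carry no type. A name is valued as an atom and, independently, as a set over every type
    [T]; the type at an occurrence selects the reading. *)
Record val (A : Type) := Val {
  vU : name -> A;
  vS : forall T, name -> interp A T -> Prop }.

Fixpoint tval {A : Type} (v : val A) (T : ty) : tm T -> interp A T :=
  match T return tm T -> interp A T with
  | TUr => vU v
  | TUnit => fun _ => tt
  | TProd a b => fun x => (tval v a (fst x), tval v b (snd x))
  | TSet T' => vS v T'
  end.

Fixpoint eenv {A : Type} (v : val A) (G : list ty) : tenv G -> env A G :=
  match G return tenv G -> env A G with
  | nil => fun _ => tt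
  | T :: G' => fun e => (tval v T (fst e), eenv v G' (snd e))
  end.

Fixpoint tlookup {G : list ty} {T : ty} (x : var G T) : tenv G -> tm T :=
  match x in var G T return tenv G -> tm T with
  | @VZ _ _ => fun e => fst e
  | @VS _ _ _ x' => fun e => tlookup x' (snd e)
  end.

Fixpoint tmeval {G : list ty} {T : ty} (t : term G T) (e : tenv G) : tm T :=
  match t with
  | tvar x => tlookup x e
  | tunit _ => tt
  | tpair t1 t2 => (tmeval t1 e, tmeval t2 e)
  | tfst t1 => fst (tmeval t1 e)
  | tsnd t1 => snd (tmeval t1 e)
  end.

Lemma lookup_eenv A (v : val A) G T (x : var G T) (e : tenv G) :
  lookup x (eenv v G e) = tval v T (tlookup x e).
Proof. induction x; simpl; auto. Qed.

Lemma teval_eenv A (v : val A) G T (t : term G T) (e : tenv G) :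
  teval t (eenv v G e) = tval v T (tmeval t e).
Proof.
  induction t; simpl.
  - apply lookup_eenv.
  - reflexivity.
  - now rewrite IHt1, IHt2.
  - now rewrite IHt.
  - now rewrite IHt.
Qed.

Fixpoint allnm (P : ty -> name -> Prop) (T : ty) : tm T -> Prop :=
  match T return tm T -> Prop with
  | TUr => P TUr
  | TUnit => fun _ => True
  | TProd a b => fun x => allnm P a (fst x) /\ allnm P b (snd x)
  | TSet T' => P (TSet T')
  end.

Fixpoint allenv (P : ty -> name -> Prop) (G : list ty) : tenv G -> Prop :=
  match G return tenv G -> Prop with
  | nil => fun _ => True
  | T :: G' => fun e => allnm P T (fst e) /\ allenv P G' (snd e)
  end.

Lemma allnm_imp (P Q : ty -> name -> Prop) T (x : tm T) :
  (forall B n, P B n -> Q B n) -> allnm P T x -> allnm Q T x.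
Proof. intros H; induction T; simpl; intuition. Qed.

Lemma allenv_imp (P Q : ty -> name -> Prop) G (e : tenv G) :
  (forall B n, P B n -> Q B n) -> allenv P G e -> allenv Q G e.
Proof. intros H; induction G; simpl; intuition eauto using allnm_imp. Qed.

Lemma allnm_lookup P G T (x : var G T) (e : tenv G) :
  allenv P G e -> allnm P T (tlookup x e).
Proof. induction x; simpl; intuition. Qed.

Lemma allnm_tmeval P G T (t : term G T) (e : tenv G) :
  allenv P G e -> allnm P T (tmeval t e).
Proof.
  intros H; induction t; simpl in *; intuition.
  now apply allnm_lookup.
Qed.

Definition agree (k : nat) {A} (v v' : val A) : Prop :=
  forall n, snd n < k -> vU v' n = vU v n /\ forall T, vS v' T n = vS v T n.

Definition below (k : nat) (_ : ty) (n : name) : Prop := snd n < k.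

Lemma agree_le k k' A (v v' : val A) : k <= k' -> agree k' v v' -> agree k v v'.
Proof. intros H H1 n Hn; apply H1; lia. Qed.

Lemma agree_trans k A (v1 v2 v3 : val A) : agree k v1 v2 -> agree k v2 v3 -> agree k v1 v3.
Proof.
  intros H1 H2 n Hn; destruct (H1 n Hn) as [a b], (H2 n Hn) as [c d].
  split; [congruence|]; intros T; now rewrite d, b.
Qed.

Lemma tval_agree k A (v v' : val A) T (x : tm T) :
  agree k v v' -> allnm (below k) T x -> tval v' T x = tval v T x.
Proof.
  intros H; induction T; simpl; intros Hx.
  - now apply H.
  - reflexivity.
  - destruct Hx; now rewrite IHT1, IHT2.
  - now apply H.
Qed.

Lemma eenv_agree k A (v v' : val A) G (e : tenv G) :
  agree k v v' -> allenv (below k) G e -> eenv v' G e = eenv v G e.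
Proof.
  intros H; induction G; simpl; intros Hx; [reflexivity|].
  destruct Hx; rewrite IHG by assumption.
  now rewrite (tval_agree _ _ H).
Qed.

(** * Fresh tuples and the extension of valuations *)

Fixpoint size (T : ty) : nat :=
  match T with
  | TUr => 1
  | TUnit => 0
  | TProd a b => size a + size b
  | TSet _ => 1
  end.

Fixpoint fresh (l : lab) (T : ty) (k : nat) : tm T :=
  match T return tm T with
  | TUr => (l, k)
  | TUnit => tt
  | TProd a b => (fresh l a k, fresh l b (k + size a))
  | TSet _ => (l, k)
  end.

Fixpoint gsize (G : list ty) : nat :=
  match G with nil => 0 | T :: G' => size T + gsize G' end.

Fixpoint freshenv (l : lab) (G : list ty) (k : nat) : tenv G :=
  match G return tenv G with
  | nil => tt
  | T :: G' => (fresh l T k, freshenv l G' (k + size T))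
  end.

Lemma fresh_allnm (P : ty -> name -> Prop) l T k :
  (forall B n, k <= n < k + size T -> P B (l, n)) -> allnm P T (fresh l T k).
Proof.
  revert k; induction T; simpl; intros k H.
  - apply H; lia.
  - exact I.
  - split; [apply IHT1 | apply IHT2]; intros; apply H; lia.
  - apply H; lia.
Qed.

Lemma freshenv_allenv (P : ty -> name -> Prop) l G k :
  (forall B n, k <= n < k + gsize G -> P B (l, n)) -> allenv P G (freshenv l G k).
Proof.
  revert k; induction G as [|T G IH]; simpl; intros k H; [exact I|].
  split; [apply fresh_allnm | apply IH]; intros; apply H; lia.
Qed.

Definition cast_set {A} (T T' : ty) (e : T = T') (S : interp A T -> Prop) : interp A T' -> Prop :=
  eq_rect T (fun T => interp A T -> Prop) S T' e.

(** The leaves of a fresh tuple are distinct names, so they can be assigned one after the other: the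
    second component of a pair starts at [k + size T1] and cannot disturb the first. *)
Lemma fresh_val A (v : val A) l T k (y : interp A T) :
  exists v', agree k v v' /\ tval v' T (fresh l T k) = y.
Proof.
  revert k v; induction T as [| |T1 IH1 T2 IH2|T _]; intros k v.
  - exists (Val (fun n => if name_dec n (l, k) then y else vU v n) (vS v)); split.
    + intros n Hn; split; [|reflexivity]; simpl.
      destruct (name_dec n (l, k)); [subst; simpl in Hn; lia | reflexivity].
    + simpl; destruct (name_dec (l, k) (l, k)); [reflexivity | congruence].
  - exists v; split; [split; reflexivity | now destruct y].
  - destruct y as [y1 y2].
    destruct (IH1 y1 k v) as (v1 & a1 & e1).
    destruct (IH2 y2 (k + size T1) v1) as (v2 & a2 & e2).
    exists v2; split.
    + eapply agree_trans; [exact a1 |]. eapply agree_le; [|exact a2]; lia.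
    + simpl; f_equal; [|exact e2].
      rewrite <- e1; apply (tval_agree _ _ a2).
      apply fresh_allnm; unfold below; simpl; lia.
  - exists (Val (vU v) (fun T' n =>
      if name_dec n (l, k) then
        match ty_dec T T' with
        | left e => cast_set e y
        | right _ => vS v T' n
        end
      else vS v T' n)); split.
    + intros n Hn; split; [reflexivity|]; simpl; intros T'.
      destruct (name_dec n (l, k)); [subst; simpl in Hn; lia | reflexivity].
    + simpl; destruct (name_dec (l, k) (l, k)); [|congruence].
      destruct (ty_dec T T) as [e'|]; [|congruence].
      unfold cast_set; now rewrite <- eq_rect_eq.
Qed.

Lemma freshenv_val A (v : val A) l G k (y : env A G) :
  exists v', agree k v v' /\ eenv v' G (freshenv l G k) = y.
Proof.
  revert k v; induction G as [|T G IH]; intros k v.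
  - exists v; split; [split; reflexivity | now destruct y].
  - destruct y as [y1 y2].
    destruct (fresh_val v l T k y1) as (v1 & a1 & e1).
    destruct (IH y2 (k + size T) v1) as (v2 & a2 & e2).
    exists v2; split.
    + eapply agree_trans; [exact a1 |]. eapply agree_le; [|exact a2]; lia.
    + simpl; f_equal; [|exact e2].
      rewrite <- e1; apply (tval_agree _ _ a2).
      apply fresh_allnm; unfold below; simpl; lia.
Qed.

(** * Derived formulas *)

Fixpoint tweak {S G T} (t : term G T) : term (S :: G) T :=
  match t with
  | tvar x => tvar (VS S x)
  | tunit _ => tunit _
  | tpair a b => tpair (tweak a) (tweak b)
  | tfst a => tfst (tweak a)
  | tsnd a => tsnd (tweak a)
  end.

Lemma teval_tweak A S G T (t : term G T) (r : env A G) (x : interp A S) :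
  teval (tweak (S := S) t) ((x, r) : env A (S :: G)) = teval t r.
Proof.
  induction t; simpl; auto.
  - now rewrite IHt1, IHt2.
  - now rewrite IHt.
  - now rewrite IHt.
Qed.

Definition tv0 {T G} : term (T :: G) T := tvar (VZ G T).

(** Only Ur-elements have equality atoms and there is no membership atom, so extensional equality is
    built by recursion on the type; [fmem] below rests on it. *)
Fixpoint feqv {T : ty} {G} : term G T -> term G T -> fml G :=
  match T return term G T -> term G T -> fml G with
  | TUr => fun a b => feq a b
  | TUnit => fun _ _ => ftop _
  | TProd T1 T2 => fun a b =>
      fand (feqv (tfst a) (tfst b)) (feqv (tsnd a) (tsnd b))
  | TSet T1 => fun a b =>
      fand (fall a (fex (tweak b) (feqv (tweak tv0) tv0)))
           (fall b (fex (tweak a) (feqv (tweak tv0) tv0)))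
  end.

Lemma sat_feqv A T G (a b : term G T) (r : env A G) :
  sat r (feqv a b) <-> teval a r = teval b r.
Proof.
  revert G a b r; induction T as [| |T1 IH1 T2 IH2|T IH]; intros G a b r.
  - reflexivity.
  - simpl. destruct (teval a r), (teval b r); tauto.
  - simpl; rewrite IH1, IH2; simpl.
    destruct (teval a r), (teval b r); simpl; intuition congruence.
  - simpl. split.
    + intros [H1 H2]; apply set_ext; intros x; split; intros Hx.
      * destruct (H1 x Hx) as (y & Hy & E); rewrite teval_tweak in Hy.
        apply IH in E; simpl in E; now subst.
      * destruct (H2 x Hx) as (y & Hy & E); rewrite teval_tweak in Hy.
        apply IH in E; simpl in E; now subst.
    + intros E; split; intros x Hx; exists x; rewrite teval_tweak;
        (split; [congruence | now apply IH]).
Qed.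

Definition fmem {T G} (x : term G T) (s : term G (TSet T)) : fml G :=
  fex s (feqv tv0 (tweak x)).

Lemma sat_fmem A T G (x : term G T) (s : term G (TSet T)) (r : env A G) :
  sat r (fmem x s) <-> teval s r (teval x r).
Proof.
  simpl; split.
  - intros (y & Hy & E); apply sat_feqv in E; rewrite teval_tweak in E; simpl in E; now subst.
  - intros H; eexists; split; [exact H|]. apply sat_feqv. now rewrite teval_tweak.
Qed.

Fixpoint fneg {G} (p : fml G) : fml G :=
  match p with
  | feq a b => fneq a b
  | fneq a b => feq a b
  | ftop _ => fbot _
  | fbot _ => ftop _
  | for_ p q => fand (fneg p) (fneg q)
  | fand p q => for_ (fneg p) (fneg q)
  | fall t p => fex t (fneg p)
  | fex t p => fall t (fneg p)
  end.

Lemma sat_fneg A G (p : fml G) (r : env A G) : sat r (fneg p) <-> ~ sat r p.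
Proof.
  induction p; simpl; try tauto.
  - rewrite IHp1, IHp2; tauto.
  - rewrite IHp1, IHp2; tauto.
  - split.
    + intros (x & Hx & H) H1; apply IHp in H; auto.
    + intros H; apply NNPP; intros H1; apply H; intros x Hx.
      apply NNPP; intros H2; apply H1; exists x; now rewrite IHp.
  - split.
    + intros H (x & Hx & H1); apply (IHp (x, r)); auto.
    + intros H x Hx; apply IHp; intros H1; apply H; eauto.
Qed.

(** * Derived NRC expressions *)

(** The return type abstracts the renaming over the tail of the matched context, so the match needs
    no equation between contexts. *)
Definition vlift {G G' : list ty} (f : forall U, var G U -> var G' U) {V W : ty}
  (x : var (V :: G) W) : var (V :: G') W :=
  match x in var L W return
    match L with
    | nil => unit
    | V :: G0 => (forall U, var G0 U -> var G' U) -> var (V :: G') W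
    end
  with
  | VZ _ _ => fun _ => VZ _ _
  | VS _ x' => fun g => VS _ (g _ x')
  end f.

Lemma lookup_vlift A G G' (f : forall U, var G U -> var G' U) V W (x : var (V :: G) W)
  (y : interp A V) (r : env A G) (r' : env A G') :
  (forall U (x : var G U), lookup (f U x) r' = lookup x r) ->
  lookup (vlift f x) ((y, r') : env A (V :: G')) = lookup x ((y, r) : env A (V :: G)).
Proof.
  revert f y r.
  refine (match x as x0 in var L W return
    match L return var L W -> Prop with
    | nil => fun _ => True
    | V :: G0 => fun x0 => forall (f : forall U, var G0 U -> var G' U)
        (y : interp A V) (r : env A G0),
        (forall U (x : var G0 U), lookup (f U x) r' = lookup x r) ->
        lookup (vlift f x0) ((y, r') : env A (V :: G')) = lookup x0 ((y, r) : env A (V :: G0))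
    end x0 with VZ _ _ => _ | VS _ _ => _ end); simpl; auto.
Qed.

Fixpoint eren {G G' T} (f : forall U, var G U -> var G' U) (e : expr G T) : expr G' T :=
  match e in expr _ T return expr G' T with
  | evar x => evar (f _ x)
  | eunit _ => eunit _
  | epair a b => epair (eren f a) (eren f b)
  | efst a => efst (eren f a)
  | esnd a => esnd (eren f a)
  | eempty _ U => eempty _ U
  | esing a => esing (eren f a)
  | eunion a b => eunion (eren f a) (eren f b)
  | ediff a b => ediff (eren f a) (eren f b)
  | ebigunion a b => ebigunion (eren (fun _ x => vlift f x) a) (eren f b)
  | eget a => eget (eren f a)
  end.

Lemma eeval_eren A (u0 : A) G T (e : expr G T) : forall G' (f : forall U, var G U -> var G' U)
  (r : env A G) (r' : env A G'),
  (forall U (x : var G U), lookup (f U x) r' = lookup x r) ->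
  eeval u0 (eren f e) r' = eeval u0 e r.
Proof.
  induction e; intros G' f r r' H; simpl; auto.
  - now rewrite (IHe1 _ f r r'), (IHe2 _ f r r').
  - now rewrite (IHe _ f r r').
  - now rewrite (IHe _ f r r').
  - now rewrite (IHe _ f r r').
  - now rewrite (IHe1 _ f r r'), (IHe2 _ f r r').
  - now rewrite (IHe1 _ f r r'), (IHe2 _ f r r').
  - apply set_ext; intros y.
    rewrite (IHe2 _ f r r' H).
    split; intros (x & Hx & Hy); exists x; split; auto;
      [ rewrite <- (IHe1 _ (fun _ x => vlift f x) (x, r) (x, r'))
      | rewrite (IHe1 _ (fun _ x => vlift f x) (x, r) (x, r')) ]; auto;
      intros; now apply lookup_vlift.
  - now rewrite (IHe _ f r r').
Qed.

Definition eweak {S G T} (e : expr G T) : expr (S :: G) T := eren (fun U x => VS S x) e.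

Lemma eeval_eweak A (u0 : A) S G T (e : expr G T) (r : env A G) (x : interp A S) :
  eeval u0 (eweak (S := S) e) ((x, r) : env A (S :: G)) = eeval u0 e r.
Proof. now apply eeval_eren. Qed.

Definition bnot {G} (e : expr G (TSet TUnit)) := ediff (esing (eunit G)) e.
Definition band {G} (a b : expr G (TSet TUnit)) := ediff a (ediff a b).
(** Difference makes equality available at every type: [{a} \ {b}] is nonempty exactly when the
    values differ, and the big union over it turns nonemptiness into a Boolean. *)
Definition beq {G T} (a b : expr G T) : expr G (TSet TUnit) :=
  bnot (ebigunion (esing (eunit _)) (ediff (esing a) (esing b))).
(** The inner big union over the Boolean [b] acts as a conditional, returning [{x}] or nothing; [VS]
    skips its unit variable. *)
Definition efilter {G T} (b : expr (T :: G) (TSet TUnit)) (c : expr G (TSet T)) : expr G (TSet T) :=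
  ebigunion (ebigunion (esing (evar (VS _ (VZ _ _)))) b) c.
Definition eprod {G T1 T2} (a : expr G (TSet T1)) (b : expr G (TSet T2))
  : expr G (TSet (TProd T1 T2)) :=
  ebigunion (ebigunion (esing (epair (evar (VS _ (VZ _ _))) (evar (VZ _ _)))) (eweak b)) a.

Section Derived.
Variables (A : Type) (u0 : A) (G : list ty) (r : env A G).

Lemma eeval_bnot (e : expr G (TSet TUnit)) : eeval u0 (bnot e) r tt <-> ~ eeval u0 e r tt.
Proof. simpl; tauto. Qed.

Lemma eeval_band (a b : expr G (TSet TUnit)) :
  eeval u0 (band a b) r tt <-> eeval u0 a r tt /\ eeval u0 b r tt.
Proof. simpl; tauto. Qed.

Lemma eeval_beq T (a b : expr G T) : eeval u0 (beq a b) r tt <-> eeval u0 a r = eeval u0 b r.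
Proof.
  unfold beq; rewrite eeval_bnot; simpl; split.
  - intros H; apply NNPP; intros H1; apply H; eauto.
  - intros E (x & [H1 H2] & _); congruence.
Qed.

Lemma eeval_efilter T (b : expr (T :: G) (TSet TUnit)) (c : expr G (TSet T)) y :
  eeval u0 (efilter b c) r y <-> eeval u0 c r y /\ eeval u0 b ((y, r) : env A (T :: G)) tt.
Proof.
  simpl; split.
  - intros (x & Hx & [] & Hb & E); now subst.
  - intros [H1 H2]; exists y; split; auto; exists tt; auto.
Qed.

Lemma eeval_eprod T1 T2 (a : expr G (TSet T1)) (b : expr G (TSet T2)) x y :
  eeval u0 a r x -> eeval u0 b r y -> eeval u0 (eprod a b) r (x, y).
Proof.
  simpl; intros Hx Hy; exists x; split; auto; exists y; split; auto.
  now rewrite eeval_eweak.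
Qed.
End Derived.
Opaque bnot band beq efilter eprod.

(** * Separation states *)

(** [IMem] is membership taken as atomic: these items supply the instances of bounded universals and
    become the elements of sets in the model. A formula such as [MEM] reduces to them through its
    bounded existential. *)
Inductive item :=
| IMem (T : ty) (x : tm T) (s : name)
| IFml (G : list ty) (p : fml G) (e : tenv G).

Definition isat {A} (v : val A) (it : item) : Prop :=
  match it with
  | IMem T x s => vS v T s (tval v T x)
  | @IFml G p e => sat (eenv v G e) p
  end.

Definition sats {A} (v : val A) (l : list item) : Prop := forall it, In it l -> isat v it.

Definition iall (P : ty -> name -> Prop) (it : item) : Prop :=
  match it with
  | IMem T x s => allnm P T x /\ P (TSet T) s
  | @IFml G _ e => allenv P G e
  end.

Definition is_fml (it : item) : Prop := match it with IMem _ _ _ => False | _ => True end.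

Definition tv1 {S T G} : term (S :: T :: G) T := tvar (VS S (VZ G T)).
Definition tv2 {R S T G} : term (R :: S :: T :: G) T := tvar (VS R (VS S (VZ G T))).

Definition EQ (n m : name) : item := IFml (feq tv0 tv1) ((n, (m, tt)) : tenv [TUr; TUr]).
Definition NEQ (n m : name) : item := IFml (fneq tv0 tv1) ((n, (m, tt)) : tenv [TUr; TUr]).
Definition EQV (T : ty) (x y : tm T) : item := IFml (feqv tv0 tv1) ((x, (y, tt)) : tenv [T; T]).
Definition NEQV (T : ty) (x y : tm T) : item :=
  IFml (fneg (feqv tv0 tv1)) ((x, (y, tt)) : tenv [T; T]).
Definition MEM (T : ty) (x : tm T) (s : name) : item :=
  IFml (fmem tv0 tv1) ((x, (s, tt)) : tenv [T; TSet T]).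
Definition NMEM (T : ty) (x : tm T) (s : name) : item :=
  IFml (fneg (fmem tv0 tv1)) ((x, (s, tt)) : tenv [T; TSet T]).
Definition SUB (T : ty) (r c : name) : item :=
  IFml (fall tv0 (fmem tv0 tv2)) ((r, (c, tt)) : tenv [TSet T; TSet T]).

Section ItemSat.
Variables (A : Type) (v : val A).

Lemma isat_EQV T (x y : tm T) : isat v (EQV T x y) <-> tval v T x = tval v T y.
Proof. unfold EQV, isat; rewrite sat_feqv; reflexivity. Qed.

Lemma isat_NEQV T (x y : tm T) : isat v (NEQV T x y) <-> tval v T x <> tval v T y.
Proof. unfold NEQV, isat; rewrite sat_fneg, sat_feqv; reflexivity. Qed.

Lemma isat_MEM T (x : tm T) s : isat v (MEM T x s) <-> vS v T s (tval v T x).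
Proof. unfold MEM, isat; rewrite sat_fmem; reflexivity. Qed.

Lemma isat_NMEM T (x : tm T) s : isat v (NMEM T x s) <-> ~ vS v T s (tval v T x).
Proof. unfold NMEM, isat; rewrite sat_fneg, sat_fmem; reflexivity. Qed.

Lemma isat_SUB T r c : isat v (SUB T r c) <-> forall y, vS v T r y -> vS v T c y.
Proof.
  unfold SUB, isat.
  change (sat (eenv v [TSet T; TSet T] (r, (c, tt))) (fall tv0 (fmem tv0 tv2)))
    with (forall y, vS v T r y ->
       sat ((y, eenv v [TSet T; TSet T] (r, (c, tt))) : env A [T; TSet T; TSet T]) (fmem tv0 tv2)).
  split; intros H y Hy; specialize (H y Hy); now rewrite sat_fmem in *.
Qed.

Lemma sats_app l1 l2 : sats v (l1 ++ l2) <-> sats v l1 /\ sats v l2.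
Proof.
  unfold sats; split.
  - intros H; split; intros it Hit; apply H, in_or_app; auto.
  - intros [H1 H2] it Hit; apply in_app_or in Hit as []; auto.
Qed.

Lemma sats_cons it l : sats v (it :: l) <-> isat v it /\ sats v l.
Proof.
  unfold sats; simpl; split.
  - intros H; split; auto.
  - intros [H1 H2] it' [<-|H]; auto.
Qed.

Lemma sats_nil : sats v [].
Proof. intros it []. Qed.
End ItemSat.

Lemma iall_imp (P Q : ty -> name -> Prop) it :
  (forall B n, P B n -> Q B n) -> iall P it -> iall Q it.
Proof.
  intros H; destruct it; simpl; intuition eauto using allnm_imp, allenv_imp.
Qed.

Lemma isat_agree k A (v v' : val A) it :
  agree k v v' -> iall (below k) it -> (isat v' it <-> isat v it).
Proof.
  intros H; destruct it; simpl.
  - intros [H1 H2]. rewrite (tval_agree _ _ H H1).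
    destruct (H s H2) as [_ E]; now rewrite E.
  - intros H1; now rewrite (eenv_agree _ _ H H1).
Qed.

Lemma sats_agree k A (v v' : val A) l :
  agree k v v' -> (forall it, In it l -> iall (below k) it) -> sats v l -> sats v' l.
Proof. intros H H1 H2 it Hit; eapply isat_agree; eauto. Qed.

(* Side [true] is the left side. The context [sG] with the tuples [sE] lists the
   variables shared by both sides. *)
Record st := mk { sk : nat; sG : list ty; sE : tenv sG; sI : bool -> list item }.

(** Definability from the shared variables, uniformly in the valuation; this is what allows a shared
    name to be used in [E] and [th]. *)
Definition den (s : st) (T : ty) (x : tm T) : Prop :=
  exists e : expr (sG s) T, forall A (u0 : A) (v : val A),
    eeval u0 e (eenv v _ (sE s)) = tval v T x.

Definition denot (s : st) (B : ty) (n : name) : Prop :=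
  match B with
  | TUr => den s TUr n
  | TSet T => den s (TSet T) n
  | _ => True
  end.

Definition good (s : st) (j : bool) (B : ty) (n : name) : Prop :=
  snd n < sk s /\ (fst n = LC \/ fst n = LS j) /\ (fst n = LC -> denot s B n).

Lemma den_allnm s T (x : tm T) : den s T x -> allnm (denot s) T x.
Proof.
  induction T as [| |T1 IH1 T2 IH2|T _]; simpl; auto.
  intros [e He]; split.
  - apply IH1; exists (efst e); intros; simpl; now rewrite He.
  - apply IH2; exists (esnd e); intros; simpl; now rewrite He.
Qed.

(** Growing contexts are compared through the tuples they define, which avoids carrying weakening
    maps between them. *)
Definition le (s s' : st) : Prop :=
  sk s <= sk s' /\ (forall T x, den s T x -> den s' T x) /\
  forall j, incl (sI s j) (sI s' j).

Lemma le_refl s : le s s.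
Proof. repeat split; auto. intros j; apply incl_refl. Qed.

Lemma le_trans s1 s2 s3 : le s1 s2 -> le s2 s3 -> le s1 s3.
Proof.
  intros (a & b & c) (a' & b' & c'); repeat split; [lia | auto |].
  intros j; eapply incl_tran; eauto.
Qed.

Lemma good_le s s' j B n : le s s' -> good s j B n -> good s' j B n.
Proof.
  intros (a & b & _) (h1 & h2 & h3); repeat split; auto; [lia|].
  intros h; specialize (h3 h); destruct B; simpl in *; auto.
Qed.

Lemma good_below s j B n : good s j B n -> below (sk s) B n.
Proof. now intros []. Qed.

(* What the left side has to be collected into a set expression besides being separated:
   nothing (plain interpolation), an atom [r], or a set [r] that is a subset of the shared
   set [c] and a member of the right-hand set [o] in every joint model. *)
Inductive mode :=
| MNone
| MUr (r : name)
| MSet (T : ty) (r o c : name).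

Definition mty (md : mode) : ty :=
  match md with MNone => TUnit | MUr _ => TUr | MSet T _ _ _ => TSet T end.

Definition hit (md : mode) {A} (v : val A) : interp A (TSet (mty md)) -> Prop :=
  match md return interp A (TSet (mty md)) -> Prop with
  | MNone => fun _ => False
  | MUr r => fun E => E (vU v r)
  | MSet T r _ _ => fun E => E (vS v T r)
  end.

Definition mgood (md : mode) (s : st) : Prop :=
  match md with
  | MNone => True
  | MUr r => good s true TUr r
  | MSet T r o c => good s true (TSet T) r /\ fst o = LS false /\ fst c = LC /\
      snd c < sk s /\ den s (TSet T) c /\ In (SUB T r c) (sI s true)
  end.

(** The second clause keeps every membership in a shared set visible on both sides. A universal over
    a shared set then finds, among the items of its own side, all elements that the model gives to
    that set. *)
Definition wf (md : mode) (s : st) : Prop :=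
  (forall j it, In it (sI s j) -> iall (good s j) it) /\
  (forall j T x n, In (IMem T x (LC, n)) (sI s j) -> forall j', In (IMem T x (LC, n)) (sI s j')) /\
  allenv (below (sk s)) (sG s) (sE s) /\
  mgood md s.

Definition Sep (md : mode) (s : st) : Prop :=
  exists (E : expr (sG s) (TSet (mty md))) (th : expr (sG s) (TSet TUnit)),
  forall A (u0 : A) (v : val A),
    (sats v (sI s true) -> ~ hit md v (eeval u0 E (eenv v _ (sE s))) ->
       eeval u0 th (eenv v _ (sE s)) tt) /\
    (sats v (sI s false) -> ~ eeval u0 th (eenv v _ (sE s)) tt).

Lemma hit_mono md A (v : val A) (E E' : interp A (TSet (mty md))) :
  (forall y, E y -> E' y) -> hit md v E -> hit md v E'.
Proof. destruct md; simpl; auto. Qed.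

Lemma hit_agree md s A (v v' : val A) (E : interp A (TSet (mty md))) :
  wf md s -> agree (sk s) v v' -> hit md v' E -> hit md v E.
Proof.
  intros (_ & _ & _ & w) H; destruct md as [|r|T r o c]; simpl in *; auto.
  - destruct (H r) as [e _]; [apply w|]; now rewrite e.
  - destruct (H r) as [_ e]; [apply w|]; now rewrite e.
Qed.

Lemma wf_sats_agree md s j A (v v' : val A) :
  wf md s -> agree (sk s) v v' -> sats v (sI s j) -> sats v' (sI s j).
Proof.
  intros (w & _) H; apply (sats_agree H); intros it Hit.
  eapply iall_imp; [|eapply w; eauto]; intros; eapply good_below; eauto.
Qed.

Lemma wf_eenv_agree md s A (v v' : val A) :
  wf md s -> agree (sk s) v v' -> eenv v' _ (sE s) = eenv v _ (sE s).
Proof. intros (_ & _ & w & _) H; apply (eenv_agree _ _ H w). Qed.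

Lemma mgood_le md s s' : le s s' -> mgood md s -> mgood md s'.
Proof.
  intros H; destruct md; simpl; auto.
  - now apply good_le.
  - destruct H as (a & b & c0) eqn:E; intros (h1 & h2 & h3 & h4 & h5 & h6).
    repeat split; auto; try apply h1.
    + destruct h1; lia.
    + intros h; simpl; apply b; apply h1; auto.
    + lia.
    + now apply c0.
Qed.

(** * Separation rules *)

Definition addl (s : st) (j : bool) (l : list item) : st :=
  mk (sk s) (sG s) (sE s) (fun j' => if eqb j j' then l ++ sI s j' else sI s j').

Definition extl (s : st) (T : ty) (j : bool) (l : list item) : st :=
  mk (sk s + size T) (sG s) (sE s) (fun j' => if eqb j j' then l ++ sI s j' else sI s j').

Definition extc (s : st) (T : ty) (t : name) (l : bool -> list item) : st :=
  let x := fresh LC T (sk s) in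
  mk (sk s + size T) (T :: sG s) (x, sE s) (fun j => IMem T x t :: l j ++ sI s j).

Lemma le_addl s j l : le s (addl s j l).
Proof.
  repeat split; auto. intros j'; simpl; destruct (eqb j j'); [|apply incl_refl].
  apply incl_appr, incl_refl.
Qed.

Lemma le_extl s T j l : le s (extl s T j l).
Proof.
  repeat split; simpl; auto; [lia|]. intros j'; destruct (eqb j j'); [|apply incl_refl].
  apply incl_appr, incl_refl.
Qed.

Lemma den_weak k' f s T (x : tm T) S (y : tm S) :
  den s T x -> den (@mk k' (S :: sG s) (y, sE s) f) T x.
Proof.
  intros [e He]; exists (eweak e); intros A u0 v; simpl; rewrite <- (He A u0 v).
  apply eeval_eweak.
Qed.

Lemma le_extc s T t l : le s (extc s T t l).
Proof.
  repeat split; simpl; [lia | intros; now apply den_weak |].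
  intros j; apply incl_tl, incl_appr, incl_refl.
Qed.

Lemma wf_addl md s j l :
  wf md s -> (forall it, In it l -> is_fml it /\ iall (good s j) it) -> wf md (addl s j l).
Proof.
  intros w H. pose proof (le_addl s j l) as Hle.
  destruct w as (w1 & w2 & w3 & w4); repeat split.
  - intros j' it; simpl; destruct (eqb j j') eqn:E; [apply eqb_prop in E; subst j'|].
    + intros Hi; apply in_app_or in Hi as [Hi|Hi].
      * eapply iall_imp; [|apply H, Hi]; intros; eapply good_le; eauto.
      * eapply iall_imp; [|eapply w1, Hi]; intros; eapply good_le; eauto.
    + intros Hi; eapply iall_imp; [|eapply w1, Hi]; intros; eapply good_le; eauto.
  - intros j' T x n Hi j''.
    apply Hle; apply w2 with (j := j').
    simpl in Hi; destruct (eqb j j'); auto.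
    apply in_app_or in Hi as [Hi|Hi]; auto.
    now destruct (H _ Hi).
  - exact w3.
  - eapply mgood_le; eauto.
Qed.

Lemma wf_extl md s T j l t :
  wf md s -> fst t = LS j ->
  (forall it, In it l -> (is_fml it \/ it = IMem T (fresh (LS j) T (sk s)) t) /\
     iall (good (extl s T j l) j) it) ->
  wf md (extl s T j l).
Proof.
  intros w Ht H. pose proof (le_extl s T j l) as Hle.
  destruct w as (w1 & w2 & w3 & w4); repeat split.
  - intros j' it; simpl; destruct (eqb j j') eqn:E; [apply eqb_prop in E; subst j'|].
    + intros Hi; apply in_app_or in Hi as [Hi|Hi].
      * now apply H.
      * eapply iall_imp; [|eapply w1, Hi]; intros; eapply good_le; eauto.
    + intros Hi; eapply iall_imp; [|eapply w1, Hi]; intros; eapply good_le; eauto.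
  - intros j' T' x n Hi j''.
    apply Hle; apply w2 with (j := j').
    simpl in Hi; destruct (eqb j j'); auto.
    apply in_app_or in Hi as [Hi|Hi]; auto.
    destruct (H _ Hi) as [[[]|E] _]. injection E; intros; subst; discriminate.
  - eapply allenv_imp; [|exact w3]; unfold below; simpl; intros; lia.
  - eapply mgood_le; eauto.
Qed.

Lemma good_fresh_extc s T t l j : allnm (good (extc s T t l) j) T (fresh LC T (sk s)).
Proof.
  assert (D : allnm (denot (extc s T t l)) T (fresh LC T (sk s))).
  { apply den_allnm. exists (evar (VZ _ _)); reflexivity. }
  assert (B : allnm (fun _ n => snd n < sk (extc s T t l) /\ fst n = LC) T (fresh LC T (sk s))).
  { apply fresh_allnm; simpl; intros; split; auto; lia. }
  revert D B; generalize (fresh LC T (sk s)); generalize (extc s T t l); clear; intros s x.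
  induction T as [| |T1 IH1 T2 IH2|T _]; simpl; unfold good; intuition.
Qed.

Lemma wf_extc md s T t l :
  wf md s -> fst t = LC -> snd t < sk s -> den s (TSet T) t ->
  (forall j it, In it (l j) -> is_fml it /\ iall (good (extc s T t l) j) it) ->
  wf md (extc s T t l).
Proof.
  intros w Ht1 Ht2 Ht3 H. pose proof (le_extc s T t l) as Hle.
  destruct w as (w1 & w2 & w3 & w4); repeat split.
  - intros j it; simpl; intros [<-|Hi].
    + simpl; split; [apply good_fresh_extc|]. eapply good_le; [exact Hle|].
      repeat split; auto.
    + apply in_app_or in Hi as [Hi|Hi].
      * now apply H.
      * eapply iall_imp; [|eapply w1, Hi]; intros; eapply good_le; eauto.
  - intros j T' x n [E|Hi] j'.
    + now left.
    + right; apply in_or_app; right; apply w2 with (j := j).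
      apply in_app_or in Hi as [Hi|Hi]; auto. now destruct (H _ _ Hi).
  - simpl; apply fresh_allnm; unfold below; simpl; lia.
  - eapply allenv_imp; [|exact w3]; unfold below; simpl; intros; lia.
  - eapply mgood_le; eauto.
Qed.

Lemma good_fresh_extl s T j l : allnm (good (extl s T j l) j) T (fresh (LS j) T (sk s)).
Proof.
  apply fresh_allnm; intros B n Hn; repeat split; simpl; auto; [lia|discriminate].
Qed.

(** A contradictory left side implies the false Boolean, a contradictory right side refutes the true
    one. *)
Lemma Sep_unsat md s j : (forall A (v : val A), ~ sats v (sI s j)) -> Sep md s.
Proof.
  intros H; exists (eempty _ _), (if j then eempty _ _ else esing (eunit _)).
  intros A u0 v; destruct j; split; simpl; intros; auto; exfalso; eapply H; eauto.
Qed.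

(** Both atoms are definable, so their equality is itself a Boolean expression; it or its negation
    interpolates. *)
Lemma Sep_clash md s n m j : den s TUr n -> den s TUr m ->
  In (EQ n m) (sI s j) -> In (NEQ n m) (sI s (negb j)) -> Sep md s.
Proof.
  intros [a Ha] [b Hb] H1 H2.
  exists (eempty _ _), (if j then beq a b else bnot (beq a b)).
  intros A u0 v.
  destruct j; simpl in H2; split; intros Hs.
  - intros _. rewrite eeval_beq, Ha, Hb; apply (Hs _ H1).
  - rewrite eeval_beq, Ha, Hb; apply (Hs _ H2).
  - intros _. rewrite eeval_bnot, eeval_beq, Ha, Hb; apply (Hs _ H2).
  - rewrite eeval_bnot, eeval_beq, Ha, Hb; intros h; apply h, (Hs _ H1).
Qed.

(** Once the left side forces [r] to equal a definable atom, the singleton of that atom collects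
    it. *)
Lemma Sep_hit s r c :
  (forall A (v : val A), sats v (sI s true) -> vU v r = vU v c) -> den s TUr c -> Sep (MUr r) s.
Proof.
  intros H [a Ha]. exists (esing a), (eempty _ _); intros A u0 v; split; simpl; auto.
  intros Hs Hn; exfalso; apply Hn; rewrite Ha; now apply H.
Qed.

(** The collections are joined; the interpolants combine by disjunction when the left side branches
    and by conjunction when the right side does. *)
Lemma Sep_branch md s j l1 l2 :
  (forall A (v : val A), sats v (sI s j) -> sats v l1 \/ sats v l2) ->
  Sep md (addl s j l1) -> Sep md (addl s j l2) -> Sep md s.
Proof.
  intros H (E1 & t1 & H1) (E2 & t2 & H2).
  exists (eunion E1 E2), (if j then eunion t1 t2 else band t1 t2).
  intros A u0 v; specialize (H A v); specialize (H1 A u0 v); specialize (H2 A u0 v).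
  simpl in H1, H2; destruct H1 as [L1 R1], H2 as [L2 R2].
  destruct j; simpl in *; split; intros Hs.
  - intros Hn; destruct (H Hs) as [h|h]; [left; apply L1 | right; apply L2];
      try (apply sats_app; auto); intros Hh; apply Hn;
      (eapply hit_mono; [|exact Hh]); simpl; auto.
  - intros [h|h]; [apply R1 | apply R2]; auto.
  - intros Hn; apply eeval_band; split; [apply L1 | apply L2]; auto;
      intros Hh; apply Hn; (eapply hit_mono; [|exact Hh]); simpl; auto.
  - rewrite eeval_band; intros [h1 h2].
    destruct (H Hs) as [h|h]; [apply R1 | apply R2]; auto; apply sats_app; auto.
Qed.

Lemma Sep_add md s j l :
  (forall A (v : val A), sats v (sI s j) -> sats v l) -> Sep md (addl s j l) -> Sep md s.
Proof. intros H H1; apply (@Sep_branch md s j l l); auto. Qed.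

(** The new tuple is outside the shared context, so a separator cannot mention it: the same [E] and
    [th] serve, read after the valuation is changed on fresh names. *)
Lemma Sep_extl md s T j l : wf md s ->
  (forall A (v : val A), sats v (sI s j) -> exists y, forall v', agree (sk s) v v' ->
     tval v' T (fresh (LS j) T (sk s)) = y -> sats v' l) ->
  Sep md (extl s T j l) -> Sep md s.
Proof.
  intros w H (E & th & H1); exists E, th; intros A u0 v; simpl in *.
  destruct (classic (sats v (sI s j))) as [Hj|Hj].
  - destruct (H A v Hj) as (y & Hy).
    destruct (fresh_val v (LS j) T (sk s) y) as (v' & Hv & He).
    specialize (Hy v' Hv He).
    destruct (H1 A u0 v') as [Lh Rh]. rewrite (wf_eenv_agree w Hv) in *.
    split; intros Hs.
    + intros Hn; apply Lh; [|intros Hh; apply Hn; eapply hit_agree; eauto].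
      destruct j; simpl; [apply sats_app; split; auto|]; eapply wf_sats_agree; eauto.
    + apply Rh.
      destruct j; simpl; [|apply sats_app; split; auto]; eapply wf_sats_agree; eauto.
  - destruct (H1 A u0 v) as [Lh Rh].
    split; intros Hs.
    + intros Hn; apply Lh; auto. destruct j; simpl; auto; contradiction.
    + apply Rh. destruct j; simpl; auto; contradiction.
Qed.

(** The new shared tuple is eliminated by ranging over [t]: collections are united over it, and the
    interpolant becomes an existential if the witness comes from the left, a universal if it comes
    from the right. *)
Lemma Sep_extc md s T t j it : wf md s -> den s (TSet T) t -> snd t < sk s ->
  (forall A (v : val A), sats v (sI s j) -> exists y, vS v T t y /\ forall v', agree (sk s) v v' ->
     tval v' T (fresh LC T (sk s)) = y -> isat v' it) ->
  Sep md (extc s T t (fun j' => if eqb j j' then [it] else [])) -> Sep md s.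
Proof.
  intros w [et Het] Ht H (E & th & H1).
  simpl in E, th.
  exists (ebigunion E et), (if j then ebigunion th et else bnot (ebigunion (bnot th) et)).
  assert (K : forall A (u0 : A) (v : val A) y, vS v T t y -> exists v', agree (sk s) v v' /\
    tval v' T (fresh LC T (sk s)) = y /\ vS v' T t (tval v' T (fresh LC T (sk s))) /\
    eenv v' (T :: sG s) (fresh LC T (sk s), sE s) = (y, eenv v _ (sE s))).
  { intros A u0 v y Hy. destruct (fresh_val v LC T (sk s) y) as (v' & Hv & He).
    exists v'; split; [exact Hv | split; [exact He | split]].
    - destruct (Hv t Ht) as [_ e]. rewrite e; congruence.
    - simpl. now rewrite (wf_eenv_agree w Hv), He. }
  assert (N : forall A (u0 : A) (v v' : val A) y, vS v T t y -> agree (sk s) v v' ->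
    ~ hit md v (eeval u0 (ebigunion E et) (eenv v _ (sE s))) ->
    ~ hit md v' (eeval u0 E ((y, eenv v _ (sE s)) : env A (T :: sG s)))).
  { intros A u0 v v' y Hy Hv Hn Hh; apply Hn.
    eapply hit_mono; [|eapply hit_agree; eauto].
    simpl; intros z Hz; exists y; split; auto. rewrite Het; exact Hy. }
  intros A u0 v; specialize (H A v).
  destruct j; split; intros Hs.
  - intros Hn; destruct (H Hs) as (y & Hy & Hi).
    destruct (K A u0 v y Hy) as (v' & Hv & e1 & e2 & e3).
    destruct (H1 A u0 v') as [Lh _]. simpl sE in Lh; simpl sG in Lh; rewrite e3 in Lh.
    exists y; split; [rewrite Het; exact Hy|]. apply Lh; [|eapply N; eauto].
    simpl; apply sats_cons; split; auto; apply sats_cons; split; auto.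
    eapply wf_sats_agree; eauto.
  - intros (y & Hy & Hth). rewrite Het in Hy.
    destruct (K A u0 v y Hy) as (v' & Hv & e1 & e2 & e3).
    destruct (H1 A u0 v') as [_ Rh]. simpl sE in Rh; simpl sG in Rh; rewrite e3 in Rh.
    revert Hth; apply Rh.
    simpl; apply sats_cons; split; auto. eapply wf_sats_agree; eauto.
  - intros Hn; rewrite eeval_bnot; intros (y & Hy & Hth). rewrite Het in Hy.
    destruct (K A u0 v y Hy) as (v' & Hv & e1 & e2 & e3).
    destruct (H1 A u0 v') as [Lh _]. simpl sE in Lh; simpl sG in Lh; rewrite e3 in Lh.
    revert Hth; rewrite eeval_bnot; intros Hth; apply Hth; apply Lh; [|eapply N; eauto].
    simpl; apply sats_cons; split; auto. eapply wf_sats_agree; eauto.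
  - rewrite eeval_bnot; intros Hth; apply Hth.
    destruct (H Hs) as (y & Hy & Hi).
    destruct (K A u0 v y Hy) as (v' & Hv & e1 & e2 & e3).
    destruct (H1 A u0 v') as [_ Rh]. simpl sE in Rh; simpl sG in Rh; rewrite e3 in Rh.
    exists y; split; [rewrite Het; exact Hy|].
    rewrite eeval_bnot; apply Rh.
    simpl; apply sats_cons; split; auto; apply sats_cons; split; auto.
    eapply wf_sats_agree; eauto.
Qed.

(* [E] collects [{z in c | th1 z}]: if [r] escapes it and both recursive collections, then
   some [z] satisfies both interpolants, which the right side refutes by looking at [w]. *)
Lemma Sep_mix T r o c s (w : name) : wf (MSet T r o c) s -> snd w < sk s ->
  Sep (MSet T r o c) (extc s T c (fun j =>
    if j then [MEM T (fresh LC T (sk s)) r] else [NMEM T (fresh LC T (sk s)) w])) ->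
  Sep (MSet T r o c) (extc s T c (fun j =>
    if j then [NMEM T (fresh LC T (sk s)) r] else [MEM T (fresh LC T (sk s)) w])) ->
  Sep (MSet T r o c) s.
Proof.
  intros wfs Hw (E1 & t1 & H1) (E2 & t2 & H2).
  simpl in E1, t1, E2, t2.
  pose proof wfs as (_ & _ & _ & Hr & _ & _ & Hc & [ec Hec] & Hsub).
  exists (eunion (esing (efilter t1 ec)) (ebigunion (eunion E1 E2) ec)),
    (ebigunion (band t1 t2) ec).
  assert (K : forall A (u0 : A) (v : val A) y, vS v T c y -> exists v', agree (sk s) v v' /\
    tval v' T (fresh LC T (sk s)) = y /\ vS v' T c (tval v' T (fresh LC T (sk s))) /\
    eenv v' (T :: sG s) (fresh LC T (sk s), sE s) = (y, eenv v _ (sE s)) /\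
    vS v' T r = vS v T r /\ vS v' T w = vS v T w).
  { intros A u0 v y Hy. destruct (fresh_val v LC T (sk s) y) as (v' & Hv & He).
    exists v'; split; [exact Hv | split; [exact He | split; [|split; [|split]]]].
    - destruct (Hv c Hc) as [_ e]. rewrite e; congruence.
    - simpl. now rewrite (wf_eenv_agree wfs Hv), He.
    - apply Hv, Hr.
    - now apply Hv. }
  intros A u0 v; split; intros Hs.
  - intros Hn; apply NNPP; intros Hth.
    assert (M1 : forall y, vS v T c y -> vS v T r y ->
      eeval u0 t1 ((y, eenv v _ (sE s)) : env A (T :: sG s)) tt).
    { intros y Hy Hry. destruct (K A u0 v y Hy) as (v' & Hv & e1 & e2 & e3 & e4 & e5).
      destruct (H1 A u0 v') as [Lh _]. simpl sE in Lh; simpl sG in Lh; rewrite e3 in Lh.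
      apply Lh.
      - simpl; apply sats_cons; split; auto; apply sats_cons; split;
          [apply isat_MEM; congruence|].
        eapply wf_sats_agree; eauto.
      - simpl; rewrite e4; intros Hh; apply Hn; simpl; right; exists y; split; auto.
        rewrite Hec; exact Hy. }
    assert (M2 : forall y, vS v T c y -> ~ vS v T r y ->
      eeval u0 t2 ((y, eenv v _ (sE s)) : env A (T :: sG s)) tt).
    { intros y Hy Hry. destruct (K A u0 v y Hy) as (v' & Hv & e1 & e2 & e3 & e4 & e5).
      destruct (H2 A u0 v') as [Lh _]. simpl sE in Lh; simpl sG in Lh; rewrite e3 in Lh.
      apply Lh.
      - simpl; apply sats_cons; split; auto; apply sats_cons; split;
          [apply isat_NMEM; congruence|].
        eapply wf_sats_agree; eauto.
      - simpl; rewrite e4; intros Hh; apply Hn; simpl; right; exists y; split; auto.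
        rewrite Hec; exact Hy. }
    apply Hn; simpl; left. apply set_ext; intros y.
    rewrite eeval_efilter, Hec. simpl.
    (* Since [r] lies in [c], a filter of [c] can equal [r] exactly. *)
    pose proof (proj1 (isat_SUB v T r c) (Hs _ Hsub)) as Hrc.
    split.
    + intros Hy; split; auto.
    + intros [Hy Ht1]; apply NNPP; intros Hry; apply Hth.
      exists y; split; [rewrite Hec; exact Hy|]. apply eeval_band; split; auto.
  - intros (y & Hy & Hth); rewrite Hec in Hy. apply eeval_band in Hth as [Ht1 Ht2].
    destruct (K A u0 v y Hy) as (v' & Hv & e1 & e2 & e3 & e4 & e5).
    destruct (H1 A u0 v') as [_ R1]. simpl sE in R1; simpl sG in R1; rewrite e3 in R1.
    destruct (H2 A u0 v') as [_ R2]. simpl sE in R2; simpl sG in R2; rewrite e3 in R2.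
    destruct (classic (vS v T w y)) as [Hwy|Hwy].
    + revert Ht2; apply R2; simpl; apply sats_cons; split; auto; apply sats_cons; split;
        [apply isat_MEM; congruence|]. eapply wf_sats_agree; eauto.
    + revert Ht1; apply R1; simpl; apply sats_cons; split; auto; apply sats_cons; split;
        [apply isat_NMEM; congruence|]. eapply wf_sats_agree; eauto.
Qed.

(** * Saturating an inseparable state *)

Definition req_item (j : bool) (it : item) (s : st) : Prop :=
  match it with
  | IMem _ _ _ => True
  | @IFml G p e =>
      match p with
      | for_ a b => In (IFml a e) (sI s j) \/ In (IFml b e) (sI s j)
      | fand a b => In (IFml a e) (sI s j) /\ In (IFml b e) (sI s j)
      | @fex _ T t a => exists x : tm T, In (IMem T x (tmeval t e)) (sI s j) /\
          In (IFml a ((x, e) : tenv (T :: G))) (sI s j)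
      | _ => True
      end
  end.

(** The two items carry independent types, so the equation [T' = T] transports the member to the
    type of the quantifier. *)
Definition req_inst (j : bool) (it m : item) (s : st) : Prop :=
  match it, m with
  | @IFml G p e, IMem T x n =>
      match p with
      | @fall _ T' t a => forall H : T' = T, n = tmeval t e ->
          In (IFml a ((eq_rect_r tm x H, e) : tenv (T' :: G))) (sI s j)
      | _ => True
      end
  | _, _ => True
  end.

(** Deciding each pair of atoms is a cut. It replaces the tableau rules for equality, because an
    entailed equation can then no longer be missing. *)
Definition req_eq (j : bool) (n m : name) (s0 s : st) : Prop :=
  good s0 j TUr n -> good s0 j TUr m -> In (EQ n m) (sI s j) \/ In (NEQ n m) (sI s j).

Definition req_mix (md : mode) (it : item) (s : st) : Prop :=
  match md with
  | MSet T r o c => forall w, it = IMem (TSet T) w o -> exists z : tm T,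
      (In (MEM T z r) (sI s true) /\ In (NMEM T z w) (sI s false)) \/
      (In (NMEM T z r) (sI s true) /\ In (MEM T z w) (sI s false))
  | _ => True
  end.

Definition mono (Q : st -> Prop) : Prop := forall s s', le s s' -> Q s -> Q s'.

(** Quantifying over every later state allows the requirements of a finite list to be met one after
    another; monotonicity preserves those already met. *)
Definition achievable (md : mode) (s : st) (Q : st -> Prop) : Prop :=
  forall s1, le s s1 -> wf md s1 -> ~ Sep md s1 ->
  exists s2, le s1 s2 /\ wf md s2 /\ ~ Sep md s2 /\ Q s2.

Lemma achieve_all md (l : list (st -> Prop)) s :
  wf md s -> ~ Sep md s -> (forall Q, In Q l -> mono Q /\ achievable md s Q) ->
  exists s', le s s' /\ wf md s' /\ ~ Sep md s' /\ forall Q, In Q l -> Q s'.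
Proof.
  intros w ns; induction l as [|Q l IH]; intros H.
  - exists s; split; [apply le_refl | split; [auto | split; [auto | intros Q []]]].
  - destruct IH as (s1 & a1 & a2 & a3 & a4); [intros; apply H; now right|].
    destruct (H Q) as [m ac]; [now left|].
    destruct (ac s1 a1 a2 a3) as (s2 & b1 & b2 & b3 & b4).
    exists s2; split; [eapply le_trans; eauto | split; [auto | split; [auto|]]].
    intros Q' [<-|HQ]; [exact b4|].
    destruct (H Q') as [m' _]; [now right|]. exact (m' _ _ b1 (a4 _ HQ)).
Qed.

Lemma achieve_add md s j l :
  wf md s -> ~ Sep md s -> (forall it, In it l -> is_fml it /\ iall (good s j) it) ->
  (forall A (v : val A), sats v (sI s j) -> sats v l) ->
  exists s', le s s' /\ wf md s' /\ ~ Sep md s' /\ forall it, In it l -> In it (sI s' j).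
Proof.
  intros w ns H1 H2; exists (addl s j l); split; [apply le_addl | split; [|split]].
  - now apply wf_addl.
  - intros h; apply ns; eapply Sep_add; eauto.
  - intros it Hi; simpl; rewrite eqb_reflx; now apply in_or_app; left.
Qed.

Lemma achieve_branch md s j a b :
  wf md s -> ~ Sep md s -> is_fml a -> is_fml b -> iall (good s j) a -> iall (good s j) b ->
  (forall A (v : val A), sats v (sI s j) -> isat v a \/ isat v b) ->
  exists s', le s s' /\ wf md s' /\ ~ Sep md s' /\ (In a (sI s' j) \/ In b (sI s' j)).
Proof.
  intros w ns fa fb ga gb H.
  assert (Hs : ~ Sep md (addl s j [a]) \/ ~ Sep md (addl s j [b])).
  { apply NNPP; intros h. apply ns; apply (@Sep_branch md s j [a] [b]).
    - intros A v Hv; destruct (H A v Hv); [left|right]; apply sats_cons; split; auto;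
        apply sats_nil.
    - tauto.
    - tauto. }
  destruct Hs as [Hs|Hs]; eexists; (split; [apply le_addl | split; [|split; [exact Hs|]]]).
  - apply wf_addl; auto. intros it [<-|[]]; auto.
  - left; simpl; rewrite eqb_reflx; now left.
  - apply wf_addl; auto. intros it [<-|[]]; auto.
  - right; simpl; rewrite eqb_reflx; now left.
Qed.

Lemma mono_req_item j it : mono (req_item j it).
Proof.
  intros s s' (_ & _ & H); specialize (H j); destruct it as [|G p e]; simpl; auto.
  destruct p; simpl; auto; firstorder.
Qed.

Lemma achieve_item md s j it : In it (sI s j) -> achievable md s (req_item j it).
Proof.
  intros Hi s1 Hle w ns.
  assert (Hi1 : In it (sI s1 j)) by now apply Hle.
  pose proof (proj1 w j it Hi1) as g.
  destruct it as [|G p e]; [exists s1; simpl; auto using le_refl|].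
  simpl in g.
  destruct p as [| | | |a b|a b| |T t a];
    try (exists s1; simpl; auto using le_refl; fail).
  - apply achieve_branch; simpl; auto.
    intros A v Hv; exact (Hv _ Hi1).
  - destruct (@achieve_add md s1 j [IFml a e; IFml b e]) as (s2 & h1 & h2 & h3 & h4); auto.
    + intros it [<-|[<-|[]]]; simpl; auto.
    + intros A v Hv; destruct (Hv _ Hi1) as [Ha Hb].
      apply sats_cons; split; auto. apply sats_cons; split; auto using sats_nil.
    + exists s2; split; auto; split; auto; split; auto. split; apply h4; simpl; auto.
  - pose proof (@allnm_tmeval (good s1 j) _ _ t e g) as gt. simpl in gt.
    destruct gt as (gt1 & gt2 & gt3).
    assert (Hex : forall A (v : val A), sats v (sI s1 j) -> exists y,
      vS v T (tmeval t e) y /\ sat ((y, eenv v G e) : env A (T :: G)) a).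
    { intros A v Hv; destruct (Hv _ Hi1) as (y & Hy & Ha).
      rewrite teval_eenv in Hy; eauto. }
    assert (ge : allenv (below (sk s1)) G e)
      by (eapply allenv_imp; [|exact g]; intros; eapply good_below; eauto).
    (* The label of the bounding set decides the witness: shared for a shared set, so that both
       sides learn of it, otherwise private to side [j]. *)
    destruct (fst (tmeval t e)) as [|j'] eqn:Et.
    + set (x := fresh LC T (sk s1)).
      set (it := IFml a ((x, e) : tenv (T :: G))).
      set (s2 := extc s1 T (tmeval t e) (fun j' => if eqb j j' then [it] else [])).
      assert (Hle2 : le s1 s2) by apply le_extc.
      exists s2; split; auto; split; [|split].
      * apply wf_extc; auto; [now apply gt3|].
        intros j' it'; destruct (eqb j j') eqn:E; [apply eqb_prop in E; subst j'|intros []].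
        intros [<-|[]]; simpl; split; auto; split; [apply good_fresh_extc|].
        eapply allenv_imp; [|exact g]; intros; eapply good_le; eauto.
      * intros h; apply ns; revert h; apply Sep_extc; auto; [now apply gt3|].
        intros A v Hv; destruct (Hex A v Hv) as (y & Hy & Ha); exists y; split; auto.
        intros v' Hv' E; subst it x; simpl. rewrite E, (eenv_agree _ _ Hv' ge); exact Ha.
      * exists x; split; simpl; [now left|]. rewrite eqb_reflx; simpl; auto.
    + destruct gt2 as [|E]; [discriminate|]. injection E as ->.
      set (x := fresh (LS j) T (sk s1)).
      set (l := [IMem T x (tmeval t e); IFml a ((x, e) : tenv (T :: G))]).
      set (s2 := extl s1 T j l).
      assert (Hle2 : le s1 s2) by apply le_extl.
      assert (gx : allnm (good s2 j) T x) by apply good_fresh_extl.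
      exists s2; split; auto; split; [|split].
      * apply wf_extl with (t := tmeval t e); auto.
        intros it' [<-|[<-|[]]]; simpl; split; auto; split; auto.
        -- eapply good_le; [exact Hle2|]. repeat split; auto.
           rewrite Et; discriminate.
        -- eapply allenv_imp; [|exact g]; intros; eapply good_le; eauto.
      * intros h; apply ns; revert h; apply Sep_extl; auto.
        intros A v Hv; destruct (Hex A v Hv) as (y & Hy & Ha); exists y.
        intros v' Hv' E; fold x in E. apply sats_cons; split.
        -- simpl; rewrite E. destruct (Hv' _ gt1) as [_ Ee]; now rewrite Ee.
        -- apply sats_cons; split; auto using sats_nil.
           simpl; rewrite E, (eenv_agree _ _ Hv' ge); exact Ha.
      * exists x; subst s2 l; simpl; rewrite eqb_reflx; simpl; auto.
Qed.

Lemma mono_req_inst j it m : mono (req_inst j it m).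
Proof.
  intros s s' (_ & _ & H); specialize (H j); destruct it as [|G p e]; simpl; auto.
  destruct m; auto. destruct p; simpl; auto.
Qed.

Lemma achieve_inst md s j it m :
  In it (sI s j) -> In m (sI s j) -> achievable md s (req_inst j it m).
Proof.
  intros Hi Hm s1 Hle w ns.
  assert (Hi1 : In it (sI s1 j)) by now apply Hle.
  assert (Hm1 : In m (sI s1 j)) by now apply Hle.
  pose proof (proj1 w j it Hi1) as g. pose proof (proj1 w j m Hm1) as gm.
  destruct it as [|G p e]; [exists s1; simpl; auto using le_refl|].
  destruct m as [T x n|]; [|exists s1; simpl; auto using le_refl].
  destruct p as [| | | | | |T' t a|];
    try (exists s1; simpl; auto using le_refl; fail).
  simpl in g, gm.
  destruct (classic (T' = T /\ n = tmeval t e)) as [[-> ->]|no].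
  - destruct (@achieve_add md s1 j [IFml a ((x, e) : tenv (T :: G))])
      as (s2 & h1 & h2 & h3 & h4); auto.
    + intros it [<-|[]]; simpl; intuition.
    + intros A v Hv; apply sats_cons; split; auto using sats_nil.
      apply (Hv _ Hi1). rewrite teval_eenv. exact (Hv _ Hm1).
    + exists s2; split; auto; split; auto; split; auto.
      intros H _. rewrite (UIP_refl _ _ H); apply h4; now left.
  - exists s1; split; auto using le_refl; split; auto; split; auto.
    intros H E; exfalso; apply no; auto.
Qed.

Lemma achieve_eq md s j n m : achievable md s (req_eq j n m s).
Proof.
  intros s1 Hle w ns.
  destruct (classic (good s j TUr n /\ good s j TUr m)) as [[gn gm]|no].
  - destruct (@achieve_branch md s1 j (EQ n m) (NEQ n m)) as (s2 & h1 & h2 & h3 & h4);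
      simpl; auto.
    + split; [|split]; auto; eapply good_le; eauto.
    + split; [|split]; auto; eapply good_le; eauto.
    + intros A v _; apply classic.
    + exists s2; split; auto; split; auto; split; auto. intros _ _; exact h4.
  - exists s1; split; auto using le_refl; split; auto; split; auto.
    intros h1 h2; exfalso; auto.
Qed.

Lemma mono_req_mix md it : mono (req_mix md it).
Proof.
  intros s s' (_ & _ & H); destruct md; simpl; auto.
  intros H1 w Hw; destruct (H1 w Hw) as [z Hz]; exists z.
  pose proof (H true); pose proof (H false); intuition.
Qed.

Lemma achieve_mix md s it : In it (sI s false) -> achievable md s (req_mix md it).
Proof.
  intros Hi s1 Hle wfs ns.
  destruct md as [| |T r o c]; try (exists s1; simpl; auto using le_refl; fail).
  destruct (classic (exists w, it = IMem (TSet T) w o)) as [[w ->]|no].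
  2:{ exists s1; split; auto using le_refl; split; auto; split; auto.
      intros w Hw; exfalso; eauto. }
  assert (Hi1 : In (IMem (TSet T) w o) (sI s1 false)) by now apply Hle.
  pose proof (proj1 wfs _ _ Hi1) as g; simpl in g.
  pose proof wfs as (_ & _ & _ & Hr & _ & c1 & c2 & c3 & _).
  assert (Hw : snd w < sk s1) by apply g.
  assert (W : forall a b, is_fml a -> is_fml b ->
    (forall s2, le s1 s2 -> (forall j, allnm (good s2 j) T (fresh LC T (sk s1))) ->
       iall (good s2 true) a /\ iall (good s2 false) b) ->
    wf (MSet T r o c) (extc s1 T c (fun j => if j then [a] else [b]))).
  { intros a b ha hb h; apply wf_extc; auto.
    destruct (h _ (le_extc s1 T c (fun j => if j then [a] else [b])) (good_fresh_extc _ _ _ _)).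
    intros j it; destruct j; intros [<-|[]]; auto. }
  assert (Hs := @Sep_mix T r o c s1 w wfs Hw).
  set (x := fresh LC T (sk s1)) in *.
  match type of Hs with ?P -> ?Q -> _ => assert (Hc : ~ P \/ ~ Q) by tauto end.
  assert (D : forall w' : name, IMem (TSet T) w o = IMem (TSet T) w' o -> w' = w).
  { intros w' E; injection E as E; apply inj_pair2 in E; now symmetry. }
  assert (V : forall s2, le s1 s2 -> good s2 true (TSet T) r /\ good s2 false (TSet T) w).
  { intros s2 Hl; split; eapply good_le; eauto; apply g. }
  destruct Hc as [Hc|Hc]; eexists;
    (split; [apply le_extc | split; [ | split; [exact Hc|]]]).
  - apply W; simpl; auto. intros s2 Hl gx; destruct (V s2 Hl); auto.
  - intros w' E; apply D in E; subst w'; exists x; left; simpl; auto.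
  - apply W; simpl; auto. intros s2 Hl gx; destruct (V s2 Hl); auto.
  - intros w' E; apply D in E; subst w'; exists x; right; simpl; auto.
Qed.

(** One round meets in [s'] the finitely many demands present in [s]; along a chain of rounds every
    item, and every pair of items, gets its turn. *)
Definition step_ok (md : mode) (s s' : st) : Prop :=
  le s s' /\
  (forall j it, In it (sI s j) -> req_item j it s') /\
  (forall j it m, In it (sI s j) -> In m (sI s j) -> req_inst j it m s') /\
  (forall j n m, req_eq j n m s s') /\
  (forall it, In it (sI s false) -> req_mix md it s').

Definition names (k : nat) : list name := list_prod [LC; LS true; LS false] (seq 0 k).

Lemma in_names k n : snd n < k -> In n (names k).
Proof.
  destruct n as [l i]; simpl; intros H; apply in_prod.
  - destruct l as [|[]]; simpl; auto.
  - apply in_seq; lia.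
Qed.

Lemma step_exists md s : wf md s -> ~ Sep md s ->
  exists s', wf md s' /\ ~ Sep md s' /\ step_ok md s s'.
Proof.
  intros w ns.
  set (L j := map (req_item j) (sI s j) ++
    map (fun p => req_inst j (fst p) (snd p)) (list_prod (sI s j) (sI s j)) ++
    map (fun p => req_eq j (fst p) (snd p) s) (list_prod (names (sk s)) (names (sk s)))).
  assert (HL : forall j Q, In Q (L j) -> mono Q /\ achievable md s Q).
  { intros j Q HQ; unfold L in HQ; rewrite !in_app_iff, !in_map_iff in HQ.
    destruct HQ as [(it & <- & Hi)|[([it m] & <- & Hi)|([n m] & <- & Hi)]].
    - split; [apply mono_req_item | now apply achieve_item].
    - apply in_prod_iff in Hi; split; [apply mono_req_inst | now apply achieve_inst].
    - split; [|apply achieve_eq].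
      intros s1 s2 (_ & _ & H) h g1 g2; destruct (h g1 g2); [left|right]; now apply H. }
  destruct (@achieve_all md (L true ++ L false ++ map (req_mix md) (sI s false)) s)
    as (s' & h1 & h2 & h3 & h4); auto.
  { intros Q HQ; rewrite !in_app_iff, in_map_iff in HQ.
    destruct HQ as [HQ|[HQ|(it & <- & Hi)]]; eauto.
    split; [apply mono_req_mix | now apply achieve_mix]. }
  assert (h5 : forall j Q, In Q (L j) -> Q s').
  { intros [] Q HQ; apply h4; rewrite !in_app_iff; auto. }
  exists s'; split; auto; split; auto; split; auto; split; [|split; [|split]].
  - intros j it Hi; apply (h5 j (req_item j it)); unfold L; rewrite !in_app_iff, !in_map_iff; eauto.
  - intros j it m Hi Hm; apply (h5 j (req_inst j it m)); unfold L.
    rewrite !in_app_iff, !in_map_iff; right; left; exists (it, m); split; auto.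
    now apply in_prod.
  - intros j n m gn gm.
    refine (h5 j (req_eq j n m s) _ gn gm); unfold L.
    rewrite !in_app_iff, !in_map_iff; right; right; exists (n, m); split; auto.
    apply in_prod; apply in_names; [apply gn | apply gm].
  - intros it Hi; apply h4; rewrite !in_app_iff, in_map_iff; eauto.
Qed.

Lemma chain_exists md s : wf md s -> ~ Sep md s ->
  exists ch : nat -> st, ch 0 = s /\
    forall n, wf md (ch n) /\ ~ Sep md (ch n) /\ step_ok md (ch n) (ch (S n)).
Proof.
  intros w ns.
  (* Dependent choice: bundling states with their invariants makes the successor a total
     function. *)
  pose (X := {s : st | wf md s /\ ~ Sep md s}).
  assert (nx : forall x : X, {y : X | step_ok md (proj1_sig x) (proj1_sig y)}).
  { intros [x [wx nsx]]; apply constructive_indefinite_description.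
    destruct (step_exists wx nsx) as (y & wy & nsy & H).
    now exists (exist _ y (conj wy nsy)). }
  pose (c := fix c n : X := match n with
     | 0 => exist _ s (conj w ns) | S n => proj1_sig (nx (c n)) end).
  exists (fun n => proj1_sig (c n)); split; [reflexivity|].
  intros n; split; [|split].
  - exact (proj1 (proj2_sig (c n))).
  - exact (proj2 (proj2_sig (c n))).
  - exact (proj2_sig (nx (c n))).
Qed.

(** * The model of a saturated chain *)

Section Model.
Variables (md : mode) (ch : nat -> st).
Hypothesis chP : forall n, wf md (ch n) /\ ~ Sep md (ch n) /\ step_ok md (ch n) (ch (S n)).

Lemma ch_le n m : n <= m -> le (ch n) (ch m).
Proof.
  induction 1; [apply le_refl|]. eapply le_trans; [eassumption|]. apply chP.
Qed.

Definition holds (j : bool) (it : item) : Prop := exists n, In it (sI (ch n) j).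
Definition gd (j : bool) (n : name) : Prop := exists i, good (ch i) j TUr n.

Lemma holds_later n m j it : n <= m -> In it (sI (ch n) j) -> In it (sI (ch m) j).
Proof. intros H; now apply ch_le. Qed.

Lemma holds_list j l : (forall it, In it l -> holds j it) ->
  exists n, forall it, In it l -> In it (sI (ch n) j).
Proof.
  induction l as [|a l IH]; intros H.
  - exists 0; intros it [].
  - destruct IH as [n Hn]; [intros; apply H; now right|].
    destruct (H a) as [m Hm]; [now left|].
    exists (n + m); intros it [<-|Hi].
    + eapply holds_later; [|exact Hm]; lia.
    + eapply holds_later; [|apply Hn, Hi]; lia.
Qed.

(** Finitely many held items occur together at one stage, and an unsatisfiable side would be
    separable. *)
Lemma holds_sat j l : (forall it, In it l -> holds j it) ->
  ~ forall A (v : val A), ~ sats v l.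
Proof.
  intros H h; destruct (holds_list l H) as [n Hn].
  apply (proj1 (proj2 (chP n))); apply Sep_unsat with (j := j).
  intros A v Hv; apply (h A v); intros it Hi; auto.
Qed.

Lemma decide_eq j n m : gd j n -> gd j m -> holds j (EQ n m) \/ holds j (NEQ n m).
Proof.
  intros [a Ha] [b Hb].
  destruct (chP (a + b)) as (_ & _ & _ & _ & _ & h & _).
  destruct (h j n m).
  - eapply good_le; [|exact Ha]; apply ch_le; lia.
  - eapply good_le; [|exact Hb]; apply ch_le; lia.
  - left; now exists (S (a + b)).
  - right; now exists (S (a + b)).
Qed.

(** The opposite inequation cannot be held, as it would be unsatisfiable together with [l]. The laws
    of equality below are instances. *)
Lemma entailed_eq j n m l : gd j n -> gd j m -> (forall it, In it l -> holds j it) ->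
  (forall A (v : val A), sats v l -> vU v n = vU v m) -> holds j (EQ n m).
Proof.
  intros gn gm Hl H; destruct (decide_eq gn gm) as [|Hn]; auto.
  exfalso; apply (@holds_sat j (NEQ n m :: l)).
  - intros it [<-|Hi]; auto.
  - intros A v Hv; apply sats_cons in Hv as [H1 H2]. now apply H1, H.
Qed.

Lemma eq_gd j n m : holds j (EQ n m) -> gd j n /\ gd j m.
Proof.
  intros [i Hi]. destruct (proj1 (proj1 (chP i)) _ _ Hi) as (h1 & h2 & _).
  split; now exists i.
Qed.

Lemma eq_refl' j n : gd j n -> holds j (EQ n n).
Proof. intros g; apply entailed_eq with (l := []); auto. intros it []. Qed.

Lemma eq_sym' j n m : holds j (EQ n m) -> holds j (EQ m n).
Proof.
  intros H; destruct (eq_gd H); apply entailed_eq with (l := [EQ n m]); auto.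
  - intros it [<-|[]]; auto.
  - intros A v Hv; symmetry; apply (Hv (EQ n m)); now left.
Qed.

Lemma eq_trans' j n m p : holds j (EQ n m) -> holds j (EQ m p) -> holds j (EQ n p).
Proof.
  intros H H1; destruct (eq_gd H), (eq_gd H1).
  apply entailed_eq with (l := [EQ n m; EQ m p]); auto.
  - intros it [<-|[<-|[]]]; auto.
  - intros A v Hv; transitivity (vU v m).
    + apply (Hv (EQ n m)); simpl; auto.
    + apply (Hv (EQ m p)); simpl; auto.
Qed.

(** A name good for both sides cannot carry a private label, so it is shared and hence definable. *)
Lemma gd_both_den j n i : gd j n -> gd (negb j) n -> good (ch i) j TUr n -> den (ch i) TUr n.
Proof.
  intros [a (_ & Ha & _)] [b (_ & Hb & _)] (_ & _ & H); apply H.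
  destruct Ha as [|Ha], Hb as [|Hb]; auto. rewrite Ha in Hb; destruct j; discriminate.
Qed.

(** The other side has decided this pair too; an inequation there would be separated by [Sep_clash],
    both names being definable. *)
Lemma eq_transfer j n m :
  holds j (EQ n m) -> gd (negb j) n -> gd (negb j) m -> holds (negb j) (EQ n m).
Proof.
  intros H gn gm; destruct (eq_gd H) as [gn' gm'].
  destruct (decide_eq gn gm) as [|[b Hb]]; auto.
  destruct H as [a Ha]; exfalso.
  apply (proj1 (proj2 (chP (a + b)))).
  assert (Ha' : In (EQ n m) (sI (ch (a + b)) j)) by (eapply holds_later; [|exact Ha]; lia).
  destruct (proj1 (proj1 (chP (a + b))) _ _ Ha') as (h1 & h2 & _).
  apply Sep_clash with (n := n) (m := m) (j := j); auto.
  - eapply gd_both_den; eauto.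
  - eapply gd_both_den; eauto.
  - eapply holds_later; [|exact Hb]; lia.
Qed.

(* Equality of atoms across the two sides always passes through a shared name. *)
Definition rel (n m : name) : Prop :=
  (exists j, holds j (EQ n m)) \/
  (exists j c, holds j (EQ n c) /\ holds (negb j) (EQ c m)).

Lemma rel_step j n m p : holds j (EQ n m) -> rel m p -> rel n p.
Proof.
  intros H [[j' H1]|(j' & c & H1 & H2)].
  - destruct (bool_dec j' j) as [->|E].
    + left; exists j; eapply eq_trans'; eauto.
    + right; exists j, m; split; auto. now replace (negb j) with j' by (destruct j, j'; simpl; congruence).
  - destruct (bool_dec j' j) as [->|E].
    + right; exists j, c; split; auto. eapply eq_trans'; eauto.
    + assert (Ej : j' = negb j) by (destruct j, j'; simpl; congruence); subst j'.
      rewrite negb_involutive in H2.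
      (* The path passes through the other side and comes back; both ends of this detour are known
         to side [j], so its equation transfers. *)
      left; exists j. eapply eq_trans'; [exact H|]. eapply eq_trans'; [|exact H2].
      rewrite <- (negb_involutive j); apply eq_transfer; auto; rewrite negb_involutive.
      * apply (eq_gd H).
      * apply (eq_gd H2).
Qed.

Lemma rel_gd j n m : gd j n -> gd j m -> rel n m -> holds j (EQ n m).
Proof.
  intros gn gm [[j' H1]|(j' & c & H1 & H2)].
  - destruct (bool_dec j' j) as [->|E]; auto.
    assert (Ej : j = negb j') by (destruct j, j'; simpl; congruence); subst j. now apply eq_transfer.
  - destruct (bool_dec j' j) as [->|E].
    + eapply eq_trans'; [exact H1|].
      rewrite <- (negb_involutive j); apply eq_transfer; auto; rewrite negb_involutive; auto.
      apply (eq_gd H1).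
    + assert (Ej : j = negb j') by (destruct j, j'; simpl; congruence); subst j.
      eapply eq_trans'; [|exact H2]. apply eq_transfer; auto. apply (eq_gd H2).
Qed.

(** The atoms of the model are the classes [rel n]: [rel_step] gives equated names the same class,
    and [rel_gd] recovers the equation from a common class. *)
Lemma rel_eq j n m : gd j n -> gd j m -> (rel n = rel m <-> holds j (EQ n m)).
Proof.
  intros gn gm; split.
  - intros E; apply rel_gd; auto. rewrite E; left; exists j; now apply eq_refl'.
  - intros H; apply set_ext; intros p; split; apply rel_step with (j := j); auto.
    now apply eq_sym'.
Qed.

(** The Mostowski collapse of the recorded memberships, by recursion on types; a set receives the
    members recorded on either side. *)
Fixpoint mval (T : ty) : tm T -> interp (name -> Prop) T :=
  match T return tm T -> interp (name -> Prop) T with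
  | TUr => rel
  | TUnit => fun _ => tt
  | TProd a b => fun x => (mval a (fst x), mval b (snd x))
  | TSet T' => fun s y => exists x, (exists j, holds j (IMem T' x s)) /\ y = mval T' x
  end.

Definition mv : val (name -> Prop) := Val rel (fun T s => mval (TSet T) s).

Lemma tval_mv T (x : tm T) : tval mv T x = mval T x.
Proof.
  induction T as [| |T1 IH1 T2 IH2|T _]; simpl; auto.
  - now rewrite IH1, IH2.
Qed.

Lemma holds_good j it : holds j it -> exists n, iall (good (ch n) j) it.
Proof. intros [n Hn]; exists n; now apply (proj1 (chP n)). Qed.

(** Sets of the model pool members from both sides, while a universal is instantiated on one side
    only. A membership recorded on the other side concerns a shared set, and those are mirrored by
    [wf]. *)
Lemma holds_mem_side j j' T x s :
  holds j' (IMem T x s) -> (fst s = LC \/ fst s = LS j) -> holds j (IMem T x s).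
Proof.
  intros [n Hn] Hs.
  destruct (proj1 (proj1 (chP n)) _ _ Hn) as (_ & _ & Hs' & _).
  destruct (bool_dec j' j) as [->|E]; [now exists n|].
  assert (Hc : fst s = LC).
  { destruct Hs as [|Hs], Hs' as [|Hs']; auto. congruence. }
  exists n. destruct s as [l i]; simpl in Hc; subst l.
  now apply (proj1 (proj2 (proj1 (chP n)))) with (j := j').
Qed.

(** The truth lemma, by induction on the formula: atoms go through [rel_eq], connectives and
    existentials through [req_item], universals through [req_inst]. *)
Lemma holds_fml j G (p : fml G) (e : tenv G) :
  holds j (IFml p e) -> sat (eenv mv G e) p.
Proof.
  revert e; induction p; intros e H.
  1,2: destruct (holds_good H) as [n g]; simpl in g;
    pose proof (@allnm_tmeval _ _ _ t e g) as gt;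
    pose proof (@allnm_tmeval _ _ _ t0 e g) as gu;
    assert (gt' : gd j (tmeval t e)) by (now exists n);
    assert (gu' : gd j (tmeval t0 e)) by (now exists n);
    simpl; rewrite !teval_eenv; simpl.
  - apply (rel_eq gt' gu'). eapply entailed_eq with (l := [IFml (feq t t0) e]); auto.
    + intros it [<-|[]]; auto.
    + intros A v Hv. specialize (Hv _ (or_introl eq_refl)); simpl in Hv.
      now rewrite !teval_eenv in Hv.
  - intros E; apply (rel_eq gt' gu') in E.
    apply (@holds_sat j [IFml (fneq t t0) e; EQ (tmeval t e) (tmeval t0 e)]).
    + intros it [<-|[<-|[]]]; auto.
    + intros A v Hv. apply sats_cons in Hv as [H1 H2]; apply sats_cons in H2 as [H2 _].
      simpl in H1; rewrite !teval_eenv in H1; now apply H1.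
  - exact I.
  - exfalso; apply (@holds_sat j [IFml (fbot _) e]).
    + intros it [<-|[]]; auto.
    + intros A v Hv. exact (Hv _ (or_introl eq_refl)).
  - destruct H as [n Hn]; destruct (chP n) as (_ & _ & _ & h & _).
    destruct (h _ _ Hn) as [h1|h1]; [left; apply IHp1 | right; apply IHp2]; now exists (S n).
  - destruct H as [n Hn]; destruct (chP n) as (_ & _ & _ & h & _).
    destruct (h _ _ Hn) as [h1 h2]; split; [apply IHp1 | apply IHp2]; now exists (S n).
  - intros y; rewrite teval_eenv, tval_mv; intros (x & [j' Hx] & ->).
    destruct (holds_good H) as [n0 g]; simpl in g.
    pose proof (@allnm_tmeval _ _ _ t e g) as (_ & gt & _).
    apply holds_mem_side with (j := j) in Hx; auto.
    destruct H as [a Ha], Hx as [b Hb].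
    assert (Ha' := @holds_later a (a + b) _ _ (Nat.le_add_r a b) Ha).
    assert (Hb' := @holds_later b (a + b) j _ ltac:(lia) Hb).
    destruct (chP (a + b)) as (_ & _ & _ & _ & h & _).
    specialize (h _ _ _ Ha' Hb' eq_refl eq_refl).
    rewrite <- tval_mv. apply (IHp (x, e)). now exists (S (a + b)).
  - destruct H as [n Hn]; destruct (chP n) as (_ & _ & _ & h & _).
    destruct (h _ _ Hn) as (x & h1 & h2). exists (tval mv _ x); split.
    + rewrite teval_eenv, (tval_mv (TSet T)), tval_mv. exists x; split; auto.
      exists j; now exists (S n).
    + apply (IHp (x, e)). now exists (S n).
Qed.

Lemma holds_isat j it : holds j it -> isat mv it.
Proof.
  destruct it as [T x s|G p e]; intros H.
  - simpl; rewrite tval_mv; exists x; eauto.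
  - now apply holds_fml with (j := j).
Qed.

(** If [r] coincided with a member of [o], the left side would equate [r] with some atom known to
    both sides; that atom is definable, so [Sep_hit] would separate. *)
Lemma model_Ur r o : md = MUr r -> fst o = LS false -> ~ vS mv TUr o (vU mv r).
Proof.
  intros E Ho (w & [j Hw] & Er). simpl in w, Er.
  assert (gr : gd true r).
  { exists 0; pose proof (proj1 (chP 0)) as (_ & _ & _ & h); rewrite E in h; exact h. }
  assert (gw : gd false w).
  { destruct Hw as [n Hn]; exists n.
    destruct (proj1 (proj1 (chP n)) _ _ Hn) as (h1 & _ & h2 & _).
    rewrite Ho in h2; destruct h2 as [|h2]; [discriminate|]; injection h2 as <-; exact h1. }
  assert (X : forall c, gd false c -> ~ holds true (EQ r c)).
  { intros c gc [n Hn].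
    destruct (proj1 (proj1 (chP n)) _ _ Hn) as (_ & h2 & _).
    apply (proj1 (proj2 (chP n))); rewrite E; apply Sep_hit with (c := c).
    - intros A v Hv; exact (Hv _ Hn).
    - apply gd_both_den with (j := true); auto. now exists n. }
  (* An equation about [r] held on the right makes [r] itself known to both sides, so [X] applies to
     [r]. *)
  assert (Y : forall c, ~ holds false (EQ r c)).
  { intros c Hc; apply (X r); [apply (eq_gd Hc) | now apply eq_refl']. }
  assert (R : rel r w) by (rewrite Er; left; exists false; now apply eq_refl').
  destruct R as [[[] H]|([] & c & H & H')].
  - now apply (X w).
  - now apply (Y w).
  - apply (X c); auto. apply (eq_gd H').
  - now apply (Y c).
Qed.

(** Members of [o] are recorded on the right because its label is private, and [req_mix] has given
    each of them a [z] on which it disagrees with [r]. *)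
Lemma model_Set T r o c : md = MSet T r o c -> ~ vS mv (TSet T) o (vS mv T r).
Proof.
  intros E (w & [j [n Hn]] & Er). simpl in w.
  assert (Hj : j = false).
  { destruct (proj1 (proj1 (chP n)) _ _ Hn) as (_ & _ & h2 & _).
    pose proof (proj1 (chP n)) as (_ & _ & _ & h); rewrite E in h.
    destruct h as (_ & h & _); rewrite h in h2. destruct h2; congruence. }
  subst j.
  destruct (chP n) as (_ & _ & _ & _ & _ & _ & h).
  specialize (h _ Hn); rewrite E in h; destruct (h w eq_refl) as (z & [[H1 H2]|[H1 H2]]).
  - assert (h1 : isat mv (MEM T z r)) by (apply holds_isat with (j := true); now exists (S n)).
    assert (h2 : isat mv (NMEM T z w)) by (apply holds_isat with (j := false); now exists (S n)).
    apply isat_MEM in h1; apply isat_NMEM in h2; apply h2.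
    change (vS mv T w) with (mval (TSet T) w). rewrite <- Er; exact h1.
  - assert (h1 : isat mv (NMEM T z r)) by (apply holds_isat with (j := true); now exists (S n)).
    assert (h2 : isat mv (MEM T z w)) by (apply holds_isat with (j := false); now exists (S n)).
    apply isat_NMEM in h1; apply isat_MEM in h2; apply h1.
    rewrite Er; exact h2.
Qed.
End Model.

Definition mode_refuted (md : mode) {A} (v : val A) : Prop :=
  match md with
  | MNone => True
  | MUr r => forall o, fst o = LS false -> ~ vS v TUr o (vU v r)
  | MSet T r o _ => ~ vS v (TSet T) o (vS v T r)
  end.

(** By contraposition: the collapse of the chain grown from an inseparable state, with atoms in
    [name -> Prop], is a joint model refuting the mode. *)
Theorem Sep_of_no_model md s : wf md s ->
  (forall A (v : val A), sats v (sI s true) -> sats v (sI s false) -> ~ mode_refuted md v) ->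
  Sep md s.
Proof.
  intros w H; apply NNPP; intros ns.
  destruct (chain_exists w ns) as (ch & e0 & Hch).
  apply (H _ (mv ch)).
  - intros it Hi; apply (holds_isat Hch) with (j := true); exists 0; now rewrite e0.
  - intros it Hi; apply (holds_isat Hch) with (j := false); exists 0; now rewrite e0.
  - destruct md; simpl; auto.
    + intros o Ho; now apply (model_Ur Hch).
    + apply (model_Set Hch eq_refl).
Qed.

(** * Collecting the elements of an implicitly defined set *)

Definition extn (s : st) (T : ty) : st :=
  mk (sk s + size T) (T :: sG s) (fresh LC T (sk s), sE s) (sI s).

Lemma le_extn s T : le s (extn s T).
Proof.
  repeat split; simpl; [lia | intros; now apply den_weak |].
  intros j; apply incl_refl.
Qed.

Lemma den_extn s T : den (extn s T) T (fresh LC T (sk s)).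
Proof. exists (evar (VZ _ _)); reflexivity. Qed.

Lemma good_of_den s j T (x : tm T) :
  den s T x -> allnm (fun _ n => snd n < sk s /\ fst n = LC) T x -> allnm (good s j) T x.
Proof.
  intros D; apply den_allnm in D; revert D.
  induction T as [| |T1 IH1 T2 IH2|T _]; simpl; unfold good; intuition.
Qed.

Lemma good_extn s T j : allnm (good (extn s T) j) T (fresh LC T (sk s)).
Proof.
  apply good_of_den; [apply den_extn|].
  apply fresh_allnm; simpl; intros; split; auto; lia.
Qed.

Lemma wf_extn s T : wf MNone s -> wf MNone (extn s T).
Proof.
  intros (w1 & w2 & w3 & w4); split; [|split; [|split; [split|exact I]]].
  - intros j it Hi; eapply iall_imp; [|eapply w1, Hi].
    intros; eapply good_le; eauto using le_extn.
  - exact w2.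
  - apply fresh_allnm; unfold below; simpl; lia.
  - eapply allenv_imp; [|exact w3]; unfold below; simpl; intros; lia.
Qed.

Lemma sats_extl s T j l A (v v' : val A) :
  wf MNone s -> agree (sk s) v v' -> sats v' l ->
  sats v (sI s true) -> sats v (sI s false) -> forall j', sats v' (sI (extl s T j l) j').
Proof.
  intros w Hv Hl H1 H2 j'; simpl.
  assert (sats v' (sI s j')) by (destruct j'; eapply wf_sats_agree; eauto).
  destruct (eqb j j'); auto. apply sats_app; auto.
Qed.

(* One inclusion is enough: in applications [s2] is a fresh right-hand name, which can always
   be interpreted by the full set. *)
Definition IMG {T U} (f : term [T; TSet T; TSet U] U) (s1 s2 : name) : item :=
  IFml (fall tv0 (fmem f tv2)) ((s1, (s2, tt)) : tenv [TSet T; TSet U]).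

Definition UNI {T} (s1 s2 : name) : item :=
  IFml (fall tv0 (fall tv0 (fmem tv0 (tweak tv2)))) ((s1, (s2, tt)) : tenv [TSet (TSet T); TSet T]).

Lemma isat_IMG A (v : val A) T U (f : term [T; TSet T; TSet U] U) s1 s2 :
  isat v (IMG f s1 s2) <-> forall y, vS v T s1 y -> vS v U s2
    (teval f ((y, (vS v T s1, (vS v U s2, tt))) : env A [T; TSet T; TSet U])).
Proof.
  unfold IMG, isat; split.
  - intros H y Hy; specialize (H y Hy); now rewrite sat_fmem in H.
  - intros H y Hy; apply sat_fmem; exact (H y Hy).
Qed.

Lemma isat_UNI A (v : val A) T s1 s2 :
  isat v (UNI (T := T) s1 s2) <-> forall y z, vS v (TSet T) s1 y -> y z -> vS v T s2 z.
Proof.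
  unfold UNI, isat; split.
  - intros H y z Hy Hz; specialize (H y Hy z Hz); now rewrite sat_fmem in H.
  - intros H y Hy z Hz; apply sat_fmem; exact (H y z Hy Hz).
Qed.

Definition collected (T : ty) (s : st) (r : tm T) : Prop :=
  exists E : expr (sG s) (TSet T), forall A (u0 : A) (v : val A),
    sats v (sI s true) -> sats v (sI s false) -> eeval u0 E (eenv v _ (sE s)) (tval v T r).

(** Quantifying over states lets the induction on [T] pass from [r] and [o] to components or
    elements in an extended state. *)
Definition collectible (T : ty) : Prop := forall s (r : tm T) (o : name),
  wf MNone s -> allnm (good s true) T r -> good s false (TSet T) o -> fst o = LS false ->
  (forall A (v : val A), sats v (sI s true) -> sats v (sI s false) -> vS v T o (tval v T r)) ->
  collected T s r.

(** The right side is given a fresh [o1] covering the image of [o] under [f]; then [r'] lies in [o1]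
    and the hypothesis for [U] applies. It serves the two projections. *)
Lemma collected_image T U (f : term [T; TSet T; TSet U] U) s (r : tm T) (r' : tm U) (o : name) :
  collectible U ->
  wf MNone s -> allnm (good s true) U r' -> good s false (TSet T) o -> fst o = LS false ->
  (forall A (v : val A), sats v (sI s true) -> sats v (sI s false) -> vS v T o (tval v T r)) ->
  (forall A (v : val A) (e : env A [TSet T; TSet U]),
     teval f ((tval v T r, e) : env A [T; TSet T; TSet U]) = tval v U r') ->
  collected U s r'.
Proof.
  intros IH w gr' go Ho H Hf.
  set (o1 := (LS false, sk s) : name).
  set (s1 := extl s (TSet U) false [IMG f o o1]).
  assert (Hle : le s s1) by apply le_extl.
  assert (go1 : good s1 false (TSet U) o1)
    by apply (good_fresh_extl s (TSet U) false [IMG f o o1]).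
  destruct (IH s1 r' o1) as (E & HE); auto.
  - apply wf_extl with (t := o); auto. intros it [<-|[]]; simpl; split; auto.
    split; [|split]; auto. eapply good_le; eauto.
  - eapply allnm_imp; [|exact gr']; intros; eapply good_le; eauto.
  - intros A v HL HR; simpl in HL, HR. apply sats_cons in HR as [Hi HR].
    rewrite isat_IMG in Hi. specialize (Hi _ (H A v HL HR)).
    rewrite (Hf A v) in Hi; exact Hi.
  - exists E; intros A u0 v HL HR.
    destruct (fresh_val v (LS false) (TSet U) (sk s) (fun _ => True)) as (v' & Hv & e).
    assert (S : forall j, sats v' (sI s1 j)).
    { eapply sats_extl; eauto. apply sats_cons; split; auto using sats_nil.
      apply isat_IMG; intros y _; simpl in e; fold o1 in e; now rewrite e. }
    specialize (HE A u0 v' (S true) (S false)); simpl in HE.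
    rewrite (wf_eenv_agree w Hv), (tval_agree _ _ Hv) in HE; auto.
    eapply allnm_imp; [|exact gr']; intros; eapply good_below; eauto.
Qed.

Lemma collect T : collectible T.
Proof.
  induction T as [| |T1 IH1 T2 IH2|T IH]; intros s r o w gr go Ho H.
  - destruct (@Sep_of_no_model (MUr r) s) as (E & th & HE).
    + destruct w as (w1 & w2 & w3 & _); repeat split; auto; apply gr.
    + intros A v HL HR Hm; exact (Hm o Ho (H A v HL HR)).
    + exists E; intros A u0 v HL HR; destruct (HE A u0 v) as [a b].
      apply NNPP; intros h; exact (b HR (a HL h)).
  - exists (esing (eunit _)); reflexivity.
  - simpl in gr; destruct gr as [g1 g2].
    destruct (@collected_image (TProd T1 T2) T1 (tfst tv0) s r (fst r) o) as (E1 & HE1); auto.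
    destruct (@collected_image (TProd T1 T2) T2 (tsnd tv0) s r (snd r) o) as (E2 & HE2); auto.
    exists (eprod E1 E2); intros A u0 v HL HR; simpl tval.
    apply eeval_eprod; auto.
  - simpl in r, gr.
    (* First the elements of [r]: an arbitrary [x] in [r] is a left-hand object lying in a
       right-hand set [o1] that covers the union of [o], so the induction hypothesis collects them
       all by one expression. *)
    assert (C : exists E : expr (sG s) (TSet T), forall A (u0 : A) (v : val A) y,
      sats v (sI s true) -> sats v (sI s false) -> vS v T r y ->
      eeval u0 E (eenv v _ (sE s)) y).
    { set (o1 := (LS false, sk s) : name).
      set (s1 := extl s (TSet T) false [UNI (T := T) o o1]).
      assert (Hle : le s s1) by apply le_extl.
      assert (go1 : good s1 false (TSet T) o1) by 
        apply (good_fresh_extl s (TSet T) false [UNI (T := T) o o1]).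
      assert (w1 : wf MNone s1).
      { apply wf_extl with (t := o); auto. intros it [<-|[]]; simpl; split; auto.
        split; [|split]; auto. eapply good_le; eauto. }
      set (x := fresh (LS true) T (sk s1)).
      set (s2 := extl s1 T true [MEM T x r]).
      assert (Hle2 : le s1 s2) by apply le_extl.
      assert (gx : allnm (good s2 true) T x) by apply good_fresh_extl.
      destruct (IH s2 x o1) as (E & HE); auto.
      - apply wf_extl with (t := (LS true, 0)); auto. intros it [<-|[]]; simpl; split; auto.
        split; [|split]; auto. eapply good_le; [exact Hle2|]. eapply good_le; eauto.
      - eapply good_le; eauto.
      - intros A v HL HR; simpl in HL, HR.
        apply sats_cons in HL as [Hx HL]. apply sats_cons in HR as [Hi HR].
        rewrite isat_UNI in Hi. apply isat_MEM in Hx.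
        exact (Hi _ _ (H A v HL HR) Hx).
      - exists E; intros A u0 v y HL HR Hy.
        destruct (fresh_val v (LS false) (TSet T) (sk s) (fun _ => True)) as (v1 & Hv1 & e1).
        destruct (fresh_val v1 (LS true) T (sk s1) y) as (v2 & Hv2 & e2).
        assert (S1 : forall j, sats v1 (sI s1 j)).
        { eapply sats_extl; eauto. apply sats_cons; split; auto using sats_nil.
          apply isat_UNI; intros y' z _ _; simpl in e1; fold o1 in e1; now rewrite e1. }
        assert (S2 : forall j, sats v2 (sI s2 j)).
        { eapply sats_extl; eauto. apply sats_cons; split; auto using sats_nil.
          apply isat_MEM; unfold x; rewrite e2.
          destruct (Hv2 r) as [_ e]; [simpl; pose proof (good_below gr); unfold below in *; lia|].
          destruct (Hv1 r) as [_ e']; [apply gr|]. now rewrite e, e'. }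
        specialize (HE A u0 v2 (S2 true) (S2 false)); unfold x in HE; rewrite e2 in HE.
        pose proof (wf_eenv_agree w1 Hv2) as q2. pose proof (wf_eenv_agree w Hv1) as q1.
        simpl in HE, q1, q2. now rewrite q2, q1 in HE. }
    destruct C as (C & HC).
    (* The shared variable [c] stands for the collection during separation; [SUB] assumes that it
       covers [r]. *)
    set (c := (LC, sk s) : name).
    set (s1 := extn s (TSet T)).
    assert (Hle : le s s1) by apply le_extn.
    assert (gc : forall j, good s1 j (TSet T) c) by (intros j; apply (good_extn s (TSet T) j)).
    set (s2 := addl s1 true [SUB T r c]).
    assert (Hle2 : le s1 s2) by apply le_addl.
    assert (gr1 : good s1 true (TSet T) r) by (eapply good_le; eauto).
    assert (w2 : wf (MSet T r o c) s2).
    { assert (w2 : wf MNone s2).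
      { apply wf_addl; [now apply wf_extn|]. intros it [<-|[]]; simpl; auto. }
      destruct w2 as (a1 & a2 & a3 & _); split; [exact a1 | split; [exact a2 | split; [exact a3|]]].
      split; [eapply good_le; eauto|].
      split; [exact Ho | split; [reflexivity | split; [apply (gc true) | split]]].
      - apply (den_extn s (TSet T)).
      - now left. }
    destruct (@Sep_of_no_model (MSet T r o c) s2 w2) as (E & th & HE).
    { intros A v HL HR; simpl in HL, HR. apply sats_cons in HL as [_ HL].
      intros Hm; exact (Hm (H A v HL HR)). }
    (* A big union over a singleton serves as a let, giving [c] the value of [C]. *)
    exists (ebigunion E (esing C)); intros A u0 v HL HR.
    set (cv := eeval u0 C (eenv v _ (sE s)) : interp A (TSet T)).
    exists cv; split; [reflexivity|].
    destruct (fresh_val v LC (TSet T) (sk s) cv) as (v' & Hv & e). simpl in e; fold c in e.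
    assert (er : vS v' T r = vS v T r) by (apply Hv, gr).
    destruct (HE A u0 v') as [a b]; simpl in a, b.
    rewrite (wf_eenv_agree w Hv) in a, b. fold c in a, b; rewrite e in a, b.
    apply NNPP; intros h. apply b; [eapply wf_sats_agree; eauto|].
    apply a; [|rewrite er; exact h].
    apply sats_cons; split; [|eapply wf_sats_agree; eauto].
    apply isat_SUB; rewrite e, er; intros y Hy; apply HC; auto.
Qed.

(** * Selecting the output among the collected candidates *)

Lemma get_sem_unique A (u0 : A) T (S : interp A T -> Prop) o :
  (forall y, S y <-> y = o) -> get_sem u0 S = o.
Proof.
  intros H; unfold get_sem; destruct excluded_middle_informative as [h|h].
  - apply H; destruct constructive_indefinite_description as [y Hy]; apply Hy.
  - exfalso; apply h; exists o; split; [now apply H | intros y Hy; symmetry; now apply H].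
Qed.

Theorem mainTheorem1 (Tin Tout : ty) (As : list ty) (Sigma : fml (Tin :: Tout :: As)) :
  implicitly_defines Sigma ->
  exists E : expr [Tin] Tout,
    forall (A : Type) (u0 : A) (i : interp A Tin) (o : interp A Tout) (a : env A As),
      sat ((i, (o, a)) : env A (Tin :: Tout :: As)) Sigma ->
      eeval u0 E ((i, tt) : env A [Tin]) = o.
Proof.
  intros Himp.
  set (G := Tout :: As).
  set (x := fresh LC Tin 0).
  (* Indices below [kL] name the shared input; those from [kL] and from [kR] name two private copies
     of the output and parameters; [k] is the first free index. *)
  set (kL := size Tin). set (kR := kL + gsize G). set (k := kR + gsize G).
  set (eL := freshenv (LS true) G kL). set (eR := freshenv (LS false) G kR).
  set (s := @mk k [Tin] (x, tt) (fun j =>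
    [IFml Sigma ((x, if j then eL else eR) : tenv (Tin :: G))])).
  assert (gx : forall j, allnm (good s j) Tin x).
  { intros j; apply good_of_den; [exists (evar (VZ _ _)); reflexivity|].
    apply fresh_allnm; simpl; intros; split; auto. unfold k, kR, kL; lia. }
  assert (gL : allenv (good s true) G eL).
  { apply freshenv_allenv; intros B n Hn; repeat split; simpl; auto; [|discriminate].
    unfold k, kR; lia. }
  assert (gR : allenv (good s false) G eR).
  { apply freshenv_allenv; intros B n Hn; repeat split; simpl; auto; [|discriminate].
    unfold k; lia. }
  assert (w : wf MNone s).
  { split; [|split; [|split; [split|]]]; simpl; auto.
    - intros [] it [<-|[]]; split; auto.
    - intros j T y n [E|[]]; discriminate.
    - eapply allnm_imp; [|exact (gx true)]; intros B n Hn; exact (proj1 Hn). }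
  assert (V : forall A (u0 : A) (i : interp A Tin) (pL pR : env A G),
    sat ((i, pL) : env A (Tin :: G)) Sigma -> sat ((i, pR) : env A (Tin :: G)) Sigma ->
    exists v : val A, tval v Tin x = i /\ eenv v G eL = pL /\ eenv v G eR = pR /\
      sats v (sI s true) /\ sats v (sI s false)).
  { intros A u0 i pL pR HL HR.
    destruct (fresh_val (Val (fun _ => u0) (fun _ _ _ => False)) LC Tin 0 i) as (v0 & _ & e0).
    destruct (freshenv_val v0 (LS true) G kL pL) as (v1 & a1 & e1).
    destruct (freshenv_val v1 (LS false) G kR pR) as (v2 & a2 & e2).
    assert (q1 : tval v2 Tin x = i).
    { rewrite <- e0; fold x. assert (b : allnm (below kL) Tin x)
        by (apply fresh_allnm; unfold below, kL; simpl; lia).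
      rewrite <- (tval_agree _ _ a1 b). apply (tval_agree _ _ a2).
      eapply allnm_imp; [|exact b]; unfold below, kR; intros; lia. }
    assert (q2 : eenv v2 G eL = pL).
    { rewrite <- e1; apply (eenv_agree _ _ a2).
      apply freshenv_allenv; unfold below, kR; simpl; lia. }
    assert (S : forall j, sats v2 (sI s j)).
    { intros j it [<-|[]].
      change (sat ((tval v2 Tin x, eenv v2 G (if j then eL else eR)) : env A (Tin :: G)) Sigma).
      rewrite q1.
      destruct j; [rewrite q2 | fold eR in e2; rewrite e2]; auto. }
    exists v2; split; [exact q1 | split; [exact q2 | split; auto]]. }
  assert (Q : forall A (v : val A), sats v (sI s true) -> sats v (sI s false) ->
    tval v Tout (fst eL) = tval v Tout (fst eR)).
  { intros A v HL HR. specialize (HL _ (or_introl eq_refl)). specialize (HR _ (or_introl eq_refl)).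
    exact (Himp _ _ _ _ _ _ HL HR). }
  (* By [Q] the left output belongs to any set containing the right output. The fresh [o1] names
     such a set, so the left output is collected. *)
  assert (HC : collected Tout s (fst eL)).
  { set (o1 := (LS false, k) : name).
    set (s1 := extl s (TSet Tout) false [MEM Tout (fst eR) o1]).
    assert (Hle : le s s1) by apply le_extl.
    assert (go1 : good s1 false (TSet Tout) o1) by 
      apply (good_fresh_extl s (TSet Tout) false [MEM Tout (fst eR) o1]).
    destruct (@collect Tout s1 (fst eL) o1) as (E & HE); auto.
    - apply wf_extl with (t := o1); auto. intros it [<-|[]]; simpl; split; auto.
      split; [|split]; auto.
      eapply allnm_imp; [|exact (proj1 gR)]; intros; eapply good_le; eauto.
    - eapply allnm_imp; [|exact (proj1 gL)]; intros; eapply good_le; eauto.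
    - intros A v HL HR; simpl sI in HL, HR. apply sats_cons in HR as [Hi HR].
      apply isat_MEM in Hi. rewrite (Q A v HL HR); exact Hi.
    - exists E; intros A u0 v HL HR.
      destruct (fresh_val v (LS false) (TSet Tout) (sk s) (fun _ => True)) as (v' & Hv & e).
      assert (S : forall j, sats v' (sI s1 j)).
      { eapply sats_extl; eauto. apply sats_cons; split; auto using sats_nil.
        apply isat_MEM; change (vS v' Tout o1) with (tval v' (TSet Tout) o1).
        simpl in e; fold k in e; fold o1 in e. simpl; now rewrite e. }
      specialize (HE A u0 v' (S true) (S false)).
      pose proof (wf_eenv_agree w Hv) as q. simpl sE in *; simpl sG in *. rewrite q in HE.
      rewrite (tval_agree _ _ Hv) in HE; auto.
      eapply allnm_imp; [|exact (proj1 gL)]; intros; eapply good_below; eauto. }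
  destruct HC as (C & HC).
  (* A shared candidate [z], equal to the output on the left and different from it on the right,
     admits no joint model by [Q]. The interpolant [th] is then a test for being the output. *)
  set (z := fresh LC Tout k).
  set (s1 := extn s Tout).
  set (s2 := addl s1 true [EQV Tout z (fst eL)]).
  set (s3 := addl s2 false [NEQV Tout z (fst eR)]).
  assert (l1 : le s s1) by apply le_extn.
  assert (l2 : le s1 s2) by apply le_addl.
  assert (gz : forall j, allnm (good s1 j) Tout z) by (intros; apply good_extn).
  destruct (@Sep_of_no_model MNone s3) as (E & th & HE).
  { apply wf_addl; [apply wf_addl; [now apply wf_extn|]|].
    - intros it [<-|[]]; simpl; split; auto. split; [auto|split; auto].
      eapply allnm_imp; [|exact (proj1 gL)]; intros; eapply good_le; eauto.
    - intros it [<-|[]]; simpl; split; auto. split; [|split; auto].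
      + eapply allnm_imp; [|exact (gz false)]; intros; eapply good_le; eauto.
      + eapply allnm_imp; [|exact (proj1 gR)]; intros; eapply good_le; [exact l2|].
        eapply good_le; eauto. }
  { intros A v HL HR _; simpl sI in HL, HR.
    apply sats_cons in HL as [h1 HL]; apply sats_cons in HR as [h2 HR].
    apply isat_EQV in h1; apply isat_NEQV in h2; apply h2.
    rewrite h1; now apply Q. }
  simpl in th.
  exists (eget (efilter th C)); intros A u0 i o a Hsat.
  apply get_sem_unique; intros y.
  (* Both copies receive the same output and parameters, so a single solution of [Sigma] yields a
     joint model. *)
  destruct (V A u0 i (o, a) (o, a) Hsat Hsat) as (v & vi & vL & vR & HL & HR).
  assert (vLo : tval v Tout (fst eL) = o) by (injection vL; auto).
  assert (vRo : tval v Tout (fst eR) = o) by (injection vR; auto).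
  assert (W : forall y, exists v', agree k v v' /\ tval v' Tout z = y /\
    eenv v' [Tout; Tin] (z, (x, tt)) = (y, (i, tt))).
  { intros y'. destruct (fresh_val v LC Tout k y') as (v' & Hv & e).
    exists v'; split; [exact Hv | split; [exact e|]].
    pose proof (wf_eenv_agree w Hv) as q; simpl in q.
    simpl; rewrite q, vi; fold z in e; now rewrite e. }
  rewrite eeval_efilter; split.
  - intros [_ Hth]. apply NNPP; intros Hy.
    destruct (W y) as (v' & Hv & e & e').
    destruct (HE A u0 v') as [_ b]; simpl sE in b; simpl sG in b. fold z in b; rewrite e' in b.
    apply b; auto. simpl sI; apply sats_cons; split; [|exact (wf_sats_agree false w Hv HR)].
    apply isat_NEQV. rewrite e; intros Hyo; apply Hy; rewrite Hyo, <- vRo.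
    apply (tval_agree _ _ Hv).
    eapply allnm_imp; [|exact (proj1 gR)]; intros B n Hn; exact (proj1 Hn).
  - intros ->; split.
    + specialize (HC A u0 v HL HR). rewrite vLo in HC. simpl in HC; now rewrite vi in HC.
    (* At [o] the left side yields [th], since mode [MNone] admits no hit. *)
    + destruct (W o) as (v' & Hv & e & e').
      destruct (HE A u0 v') as [b _]; simpl sE in b; simpl sG in b. fold z in b; rewrite e' in b.
      apply b; auto. simpl sI; apply sats_cons; split; [|exact (wf_sats_agree true w Hv HL)].
      apply isat_EQV. rewrite e, <- vLo; symmetry; apply (tval_agree _ _ Hv).
      eapply allnm_imp; [|exact (proj1 gL)]; intros B n Hn; exact (proj1 Hn).
Qed.
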